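(* Let $X\subset P^N(\mathbf{C})$ be a submanifold of dimension $n$ with degenerate Gauss map of rank $r$ ($2\le r<n$), with plane generators $L$ of dimension $l=n-r$, satisfying the standing assumptions of the context. Suppose that $l\ge 2$, and that (for all values of the parameters $u\in M$) the focus hypersurfaces $F_L\subset L$ do not have multiple components and are indecomposable. Then $X$ is a hypersurface of rank $r$ in a projective subspace $P^{n+1}\subset P^N$.
   Context: Setting. $X\subset P^N(\mathbf{C})$ is a smooth $n$-dimensional submanifold whose Gauss map $\gamma:X\to G(n,N)$, $\gamma(x)=T_x(X)$ (the tangent subspace, an $n$-dimensional projective subspace), has constant rank $r<n$; $r$ is called the rank of $X$. The leaves of $\gamma$ are (open parts of) projective subspaces $L$ of dimension $l=n-r$. They are extended to full projective subspaces $P^l$, also denoted $L$ and called plane generators of $X$, so that $X=f(P^l\times M^r)$, with $M$ an $r$-dimensional parameter variety with parameters $u=(u^p)$ and $f:P^l\times M\to P^N$ differentiable. $T_L\supset L$ denotes the $n$-dimensional tangent subspace, constant along $L$. Frames and matrices. Index ranges: $i,j=0,\dots,l$; $p,q,s=l+1,\dots,n$; $\alpha=n+1,\dots,N$. Take projective frames $\{A_0,\dots,A_N\}$ with $A_i\in L$ and $A_i,A_p\in T_L$, and write $dA_a=\sum_b\omega_a^bA_b$ for $a,b=0,\dots,N$. Let $\theta^p$ be basis 1-forms on $M$. Then (summation over repeated indices) $\omega_i^\alpha=0$, $\omega_i^p=c^p_{qi}\theta^q$, $\omega_p^\alpha=b^\alpha_{qp}\theta^q$. Put $C_i=(c^p_{qi})$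 and $B^\alpha=(b^\alpha_{qp})$, $r\times r$ matrices. They satisfy $b^\alpha_{qs}c^s_{pi}=b^\alpha_{ps}c^s_{qi}$, i.e. the products $H^\alpha_i=B^\alpha C_i=(h^\alpha_{ipq})$ are symmetric, and $h_i^\alpha=h^\alpha_{ipq}\theta^p\theta^q$ are the second fundamental forms of $X$. Focus hypersurface. $F_L\subset L$ is the algebraic hypersurface of degree $r$ given by $\det(c^q_{pi}x^i)=0$ for $x=x^iA_i\in L$. ''Indecomposable'' means irreducible as an algebraic hypersurface. Standing assumptions. $r>1$; for all $u\in M$ the system of forms $h_i^\alpha$ is regular, i.e. among them there is at least one nondegenerate quadratic form; all conditions in theorems are assumed to hold for all $u\in M$.
   Formalization: The parameter variety M is assumed connected (and nonempty); otherwise two copies of such a hypersurface, e.g. the symmetric determinantal cubic, placed in disjoint subspaces P^{n+1} of P^N would be a counterexample. *)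

(* Defs.v *)
From HB Require Import structures.
From mathcomp Require Import all_boot all_order all_algebra.
From mathcomp Require Import all_classical all_reals all_analysis.
From mathcomp Require Import complex.
(* the notations of mpoly clash with those of the analysis library *)
From mathcomp Require Import -(notations) mpoly.

Set Implicit Arguments.
Unset Strict Implicit.
Unset Printing Implicit Defensive.

Import Order.TTheory GRing.Theory Num.Theory.
Import numFieldNormedType.Exports.
Local Open Scope classical_set_scope.
Local Open Scope ring_scope.

(* The topology of R[i] given by its norm; that of 'rV[R[i]]_r is the product
   topology. *)
HB.instance Definition _ (R : rcfType) := PseudoPointedMetric.copy R[i] R[i]^o.

(* [differentiable] and ['D_v] are taken over the scalar field [R[i]], so the
   derivatives below are complex derivatives and a smooth map is a holomorphic
   one.  [U] is meant to be open. *)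
Fixpoint Cn_on (R : realType) (r p q k : nat) (U : set 'rV[R[i]]_r)
    (f : 'rV[R[i]]_r -> 'M[R[i]]_(p, q)) : Prop :=
  match k with
  | 0 => forall x, U x -> f y @[y --> x] --> f x
  | k'.+1 => (forall x, U x -> differentiable f x) /\
             (forall v, Cn_on k' U ('D_v f))
  end.

Definition smooth_on (R : realType) (r p q : nat) (U : set 'rV[R[i]]_r)
    (f : 'rV[R[i]]_r -> 'M[R[i]]_(p, q)) : Prop :=
  forall k, Cn_on k U f.

(* A chart is a homeomorphism from [cdom] onto the open set [cmap @` cdom];
   the values of [cmap] and [cinv] elsewhere are irrelevant. *)
Record chart (R : realType) (M : topologicalType) (r : nat) := Chart {
  cdom : set M;
  cmap : M -> 'rV[R[i]]_r;
  cinv : 'rV[R[i]]_r -> M;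
  chart_open : open cdom;
  chart_open_image : open (cmap @` cdom);
  chartK : forall u, cdom u -> cinv (cmap u) = u;
  chart_continuous : {within cdom, continuous cmap};
  chart_inv_continuous : {within cmap @` cdom, continuous cinv} }.

Record complex_atlas (R : realType) (M : topologicalType) (r : nat) :=
  ComplexAtlas {
  charts : set (chart R M r);
  charts_cover : forall u, exists2 c, charts c & cdom c u;
  charts_compat : forall c d, charts c -> charts d ->
    smooth_on (cmap c @` (cdom c `&` cdom d)) (cmap d \o cinv c) }.

Record connected_manifold (M : topologicalType) : Prop := ConnectedManifold {
  manifold_hausdorff : hausdorff_space M;
  manifold_second_countable : @second_countable M;
  manifold_nonempty : [set: M] !=set0;
  manifold_connected : connected [set: M] }.

(* Conventions.  With n = l + r and N = n + m, points of P^N are the nonzero row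
   vectors of length N + 1 = l.+1 + r + m up to scaling, and a projective
   subspace is the row space of a matrix (so P^l has vector space dimension
   l.+1).  The splitting l.+1 + r + m of the indices 0, ..., N is the splitting
   into the ranges i, p and alpha. *)

Section MovingFrames.
Context {R : realType} {M : topologicalType} {l r m : nat}.
Implicit Types (At : complex_atlas R M r) (c : chart R M r) (u : M) (V : set M).
Implicit Types (A : M -> 'M[R[i]]_(l.+1 + r + m)).
Implicit Types (L : M -> 'M[R[i]]_(l.+1, l.+1 + r + m)).
Implicit Types (T : M -> 'M[R[i]]_(l.+1 + r, l.+1 + r + m)).
Implicit Types (X : set 'rV[R[i]]_(l.+1 + r + m)).

(* The rows of [A u] are the frame vectors A_0, ..., A_N; the frame field is
   defined and smooth on the open set [V], contained in the domain of [c]. *)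
Definition adapted_frame At L T c V A : Prop :=
  [/\ charts At c, open V, V `<=` cdom c,
      smooth_on (cmap c @` V) (A \o cinv c) &
      forall u, V u ->
        [/\ A u \in unitmx,
            (usubmx (usubmx (A u)) :=: L u)%MS &
            (usubmx (A u) :=: T u)%MS]].

(* the partial derivative along the coordinate u^q of the chart [c] *)
Definition partial (a b : nat) c (q : 'I_r) (f : M -> 'M[R[i]]_(a, b)) u :
    'M[R[i]]_(a, b) :=
  'D_(delta_mx 0 q) (f \o cinv c) (cmap c u).

(* dA_a = omega_a^b A_b: the entry (a, b) of [omega c A q u] is the coefficient
   of theta^q = du^q in omega_a^b. *)
Definition omega c A (q : 'I_r) u : 'M[R[i]]_(l.+1 + r + m) :=
  partial c q A u *m invmx (A u).

(* omega_i^p = c^p_{qi} theta^q, with p the row index of C_i *)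
Definition Cmx c A u (i : 'I_l.+1) : 'M[R[i]]_r :=
  \matrix_(p, q) omega c A q u (lshift m (lshift r i)) (lshift m (rshift l.+1 p)).

(* omega_p^alpha = b^alpha_{qp} theta^q, with q the row index of B^alpha *)
Definition Bmx c A u (al : 'I_m) : 'M[R[i]]_r :=
  \matrix_(q, p) omega c A q u (lshift m (rshift l.+1 p)) (rshift (l.+1 + r) al).

(* the matrix of the second fundamental form h_i^alpha *)
Definition Hmx c A u (i : 'I_l.+1) (al : 'I_m) : 'M[R[i]]_r :=
  Bmx c A u al *m Cmx c A u i.

(* The parametrization f(x, u) = x^i A_i(u) of X, in homogeneous coordinates. *)
Definition param A (x : 'rV[R[i]]_l.+1) u : 'rV[R[i]]_(l.+1 + r + m) :=
  x *m usubmx (usubmx (A u)).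

(* The partial derivatives of [param A] at (x, u), first along the l.+1
   coordinates of x, then along those of u.  X is an immersed n-dimensional
   submanifold at that point when they are linearly independent, and their span
   is then the projective tangent subspace of X. *)
Definition tangent_mx c A (x : 'rV[R[i]]_l.+1) u :
    'M[R[i]]_(l.+1 + r, l.+1 + r + m) :=
  col_mx (usubmx (usubmx (A u))) (\matrix_(q < r) partial c q (param A x) u).

(* The differential at u of the map T from M to the Grassmannian G(n, N): the
   tangent space of G(n, N) at T is Hom(T, C^(N+1) / T), and the image of the
   q-th coordinate vector is A_a |-> dA_a mod T (0 <= a <= n), whose matrix has
   the entries omega_a^alpha. *)
Definition gauss_diff c A u : 'M[R[i]]_(r, (l.+1 + r) * m) :=
  \matrix_(q < r) mxvec (ursubmx (omega c A q u)).

(* [X] (as a set of homogeneous coordinate vectors) is a submanifold of P^N of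
   dimension n = l + r with plane generators [L u], u in M, whose Gauss map has
   the constant rank r: the tangent subspace of X is constant, equal to [T u],
   along [L u].  Over the complex numbers every generator carries points where
   f is not immersive (the foci), so that X is smooth, and the Gauss map
   defined, at the other points only. *)
Record degenerate_gauss At X L T : Prop := DegenerateGauss {
  dg_frame : forall u, exists c V A, adapted_frame At L T c V A /\ V u;
  dg_points : X = [set x | x != 0 /\ exists u, (x <= L u)%MS];
  dg_dim : forall c V A, adapted_frame At L T c V A ->
    forall u, V u -> exists x, row_free (tangent_mx c A x u);
  dg_tangent : forall c V A, adapted_frame At L T c V A ->
    forall u, V u -> forall x, row_free (tangent_mx c A x u) ->
    (tangent_mx c A x u :=: T u)%MS;
  dg_rank : forall c V A, adapted_frame At L T c V A ->
    forall u, V u -> \rank (gauss_diff c A u) = r }.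

(* Unlike the other conditions, the nondegeneracy of one of the h_i^alpha depends
   on the frame; it is required for some adapted frame around each point. *)
Definition regular_second_forms At L T : Prop :=
  forall u, exists c V A, [/\ adapted_frame At L T c V A, V u &
    exists i al, Hmx c A u i al \in unitmx].

(* The left-hand side det(c^q_{pi} x^i) of the equation of F_L.  Changing the
   chart or the adapted frame amounts to an invertible linear substitution in x
   and a nonzero constant factor. *)
Definition focus_poly c A u : mpoly l.+1 R[i] :=
  \det (\matrix_(p, q) \sum_(i < l.+1)
          Cmx c A u i q p *: mpolyX R[i] (mnm1 i)).

End MovingFrames.

(* A hypersurface is given by an equation F = 0; its components are given by the
   irreducible factors of F up to scalars.  [1 < msize F] says that F is not
   constant. *)
Definition mpoly_irreducible (R : realType) (n : nat)
    (F : mpoly n R[i]) : Prop :=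
  (1 < msize F)%N /\
  forall G H, F = G * H -> (msize G <= 1)%N \/ (msize H <= 1)%N.

Definition component (R : realType) (n : nat) (F G : mpoly n R[i]) : Prop :=
  mpoly_irreducible G /\ exists Q, F = G * Q.

Definition no_multiple_components (R : realType) (n : nat)
    (F : mpoly n R[i]) : Prop :=
  forall G, component F G -> ~ exists Q, F = G ^+ 2 * Q.

Definition indecomposable (R : realType) (n : nat)
    (F : mpoly n R[i]) : Prop :=
  exists2 G, component F G & forall H, component F H -> exists a : R[i], H = a *: G.

(* Main.v *)
Require Import Defs.
From mathcomp Require Import all_boot all_order all_algebra.
From mathcomp Require Import all_classical all_reals all_analysis.
From mathcomp Require Import complex.
From mathcomp Require Import ring.
From mathcomp Require Import -(notations) mpoly.
Import Order.TTheory GRing.Theory Num.Theory.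
Import numFieldNormedType.Exports.
Local Open Scope classical_set_scope.
Local Open Scope ring_scope.

Set Implicit Arguments.
Unset Strict Implicit.
Unset Printing Implicit Defensive.

(** The proof has a pointwise algebraic half and a differential half.

    Algebra.  Where [B0 *m C i0] is invertible, put [h := B0 *m C i0].  The
    symmetry of all the products [B0 *m C i] and [B *m C i] says that the
    matrices [(C i0)^-1 *m C i] and [h^-1 *m (B *m C i0)] are self-adjoint for
    the bilinear form [h], and that the latter commutes with all the former.
    Over an algebraically closed field it has an eigenvalue [a]; if it were not
    the scalar [a], the image of its difference with [a] would be a proper
    nonzero subspace invariant under the whole pencil of the [C i], and
    [det (sum_i x_i C_i)] would split into the determinants on the subspace and
    on the quotient ([pencil_reducible]).  As the focus polynomial is
    irreducible, [B = a B0] ([second_forms_proportional]): all the B^alpha are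
    multiples of one of them, that is, the tangent subspace [T u] and its first
    derivatives span a subspace [W u] of vector space dimension n + 2 only.

    Calculus.  This second osculating subspace is locally constant
    ([osculating_space_constant]).  Modulo [W], the first derivatives of a basis
    [a] of [T] have the form D_v a = mu_v g for a single vector field [g] and a
    linear map [v |-> mu_v] to columns, which is injective because the rank of
    the Gauss map is [r].  Differentiating once more, the symmetry of the second
    derivatives gives mu_v (D_s g) = mu_s (D_v g) modulo [W].  When [r >= 2],
    some [v] is not a multiple of [s], so that mu_v and mu_s are linearly
    independent, and D_s g lies in [W].  Hence [W] has zero derivative.

    The symmetry of second derivatives also gives the symmetry of the matrices
    B^alpha C_i ([normal_focal_sym]), provided that the derivatives of the
    generators stay tangent; this is the constancy of the tangent subspace along
    a generator, extended from its smooth points to all of it by genericity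
    ([frame_generators_tangent]).  Finally [W] contains [T] near each point and
    is the only subspace of its dimension to do so ([osculating_space_unique]),
    so that the local constancy globalizes over the connected parameter space.
    All tangent subspaces then lie in one fixed P^(n+1), and taking coordinates
    in it transports the whole structure ([degenerate_gauss_reduction]). *)

(** * Differential calculus of matrix-valued maps *)

Section Differentiability.
Context {K : numFieldType} {V W : normedModType K}.
Implicit Types (x v : V).

Lemma differentiable_littleo (f : V -> W) x : differentiable f x ->
  forall e, 0 < e ->
  \forall y \near x, `|f y - f x - 'd f x (y - x)| <= e * `|y - x|.
Proof.
move=> /diffP[_]; rewrite lim_id // => /funext.
move/(@eqadd_some_oP _ _ _ _ (nbhs x)) => H e e0.
have := H e e0; apply: filterS => y.
by rewrite opprD addrA.
Qed.

Lemma littleo_differentiable (f : V -> W) (df : {linear V -> W}) x :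
  continuous df ->
  (forall e, 0 < e ->
     \forall y \near x, `|f y - f x - df (y - x)| <= e * `|y - x|) ->
  differentiable f x.
Proof.
move=> dfc H; apply/diffP.
apply: (@getPex _ (fun (df : {linear V -> W}) => continuous df /\
  forall y, f y = f (lim (nbhs x)) + df (y - lim (nbhs x))
                  +o_(y \near x) (y - lim (nbhs x)))).
exists df; split=> //; rewrite lim_id //.
apply/funeqP; apply/(@eqaddoP _ _ _ _ (nbhs x)) => e e0.
apply: filterS (H e e0) => y; rewrite -addrA -opprD //.
Qed.

Lemma near_eq_differentiable (f g : V -> W) x :
  (\near x, f x = g x) -> differentiable f x -> differentiable g x.
Proof.
move=> fg df; apply: (@littleo_differentiable _ ('d f x)).
  exact: diff_continuous.
move=> e e0; have := differentiable_littleo df e0.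
rewrite (nbhs_singleton fg); apply: filterS2 fg => y <-.
by [].
Qed.

End Differentiability.

Section MatrixCalculus.
Context {K : numFieldType} {V : normedModType K}.
Implicit Types (x v : V).

Lemma derive_coord m n (f : V -> 'M[K]_(m, n)) x v i j :
  differentiable f x -> 'D_v (fun y => f y i j) x = 'D_v f x i j.
Proof.
move=> df.
have @g : {linear 'M[K]_(m, n) -> K}.
  by exists (fun N : 'M[K]_(_, _) => N i j); do 2![eexists]; do ?[constructor];
     rewrite ?mxE// => ? *; rewrite ?mxE//; move=> ?; rewrite !mxE.
have gc : continuous g by exact: coord_continuous.
have dg : differentiable g (f x) by exact: linear_differentiable.
have -> : (fun y => f y i j) = g \o f by [].
rewrite !deriveE //; last exact: differentiable_comp.
rewrite (diff_comp df dg) /= (diff_lin _ gc).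
by [].
Qed.

Lemma differentiable_mxP m n (f : V -> 'M[K]_(m, n)) x :
  differentiable f x <-> forall i j, differentiable (fun y => f y i j) x.
Proof.
split=> [df i j|df].
  apply: (@differentiable_comp _ _ _ _ f (fun M : 'M[K]_(m, n) => M i j)) => //.
  exact: differentiable_coord.
have -> : f = \sum_(i < m) \sum_(j < n) (fun y => f y i j *: delta_mx i j).
  apply/funext => y; rewrite [LHS]matrix_sum_delta fct_sumE.
  by apply: eq_bigr => i _; rewrite fct_sumE.
apply: differentiable_sum => i; apply: differentiable_sum => j.
exact: differentiableZl.
Qed.

Lemma differentiable_mx_coord m n (f : V -> 'M[K]_(m, n)) x i j :
  differentiable f x -> differentiable (fun y => f y i j) x.
Proof. by move=> /differentiable_mxP. Qed.

Lemma differentiable_mulmx m n p (f : V -> 'M[K]_(m, n)) (g : V -> 'M[K]_(n, p)) x :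
  differentiable f x -> differentiable g x ->
  differentiable (fun y => f y *m g y) x.
Proof.
move=> /differentiable_mxP df /differentiable_mxP dg.
apply/differentiable_mxP => i j.
have -> : (fun y => (f y *m g y) i j) =
    \sum_(k < n) ((fun y => f y i k) * (fun y => g y k j)).
  by apply/funext => y; rewrite mxE fct_sumE.
by apply: differentiable_sum => k; exact: differentiableM.
Qed.

Lemma derive_mulmx m n p (f : V -> 'M[K]_(m, n)) (g : V -> 'M[K]_(n, p)) x v :
  differentiable f x -> differentiable g x ->
  'D_v (fun y => f y *m g y) x = 'D_v f x *m g x + f x *m 'D_v g x.
Proof.
move=> df dg; have dfg := differentiable_mulmx df dg.
move: (df) (dg) => /differentiable_mxP dfc /differentiable_mxP dgc.
apply/matrixP => i j; rewrite -(derive_coord _ _ _ dfg).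
have -> : (fun y => (f y *m g y) i j) =
    \sum_(k < n) ((fun y => f y i k) * (fun y => g y k j)).
  by apply/funext => y; rewrite mxE fct_sumE.
rewrite derive_sum; last first.
  by move=> k; apply/diff_derivable; exact: differentiableM.
rewrite !mxE -big_split /=; apply: eq_bigr => k _.
rewrite deriveM; [|exact: diff_derivable..].
rewrite !derive_coord // addrC; congr (_ + _).
by rewrite /GRing.scale /= mulrC.
Qed.

Lemma differentiable_mxcst m n (A : 'M[K]_(m, n)) x :
  differentiable (fun=> A : 'M[K]_(m, n)) x.
Proof. exact: differentiable_cst. Qed.

Lemma derive_mulmxr m n p (f : V -> 'M[K]_(m, n)) (B : 'M[K]_(n, p)) x v :
  differentiable f x -> 'D_v (fun y => f y *m B) x = 'D_v f x *m B.
Proof. by move=> df; rewrite derive_mulmx // derive_cst mulmx0 addr0. Qed.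

Lemma derive_mulmxl m n p (A : 'M[K]_(m, n)) (f : V -> 'M[K]_(n, p)) x v :
  differentiable f x -> 'D_v (fun y => A *m f y) x = A *m 'D_v f x.
Proof. by move=> df; rewrite derive_mulmx // derive_cst mul0mx add0r. Qed.

Lemma differentiable_fun_prod (I : Type) (s : seq I) (P : pred I)
    (f : I -> V -> K) x :
  (forall i, differentiable (f i) x) ->
  differentiable (fun y => \prod_(i <- s | P i) f i y) x.
Proof.
move=> df; elim: s => [|i s IHs].
  under eq_fun do rewrite big_nil; exact: differentiable_cst.
under eq_fun do rewrite big_cons; case: (P i) => //.
by have := differentiableM (df i) IHs.
Qed.

Lemma differentiable_fun_sum (I : Type) (s : seq I) (P : pred I)
    (f : I -> V -> K) x :
  (forall i, differentiable (f i) x) ->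
  differentiable (fun y => \sum_(i <- s | P i) f i y) x.
Proof.
move=> df; elim: s => [|i s IHs].
  under eq_fun do rewrite big_nil; exact: differentiable_cst.
under eq_fun do rewrite big_cons; case: (P i) => //.
by have := differentiableD (df i) IHs.
Qed.

Lemma differentiable_det n (f : V -> 'M[K]_n) x :
  differentiable f x -> differentiable (fun y => \det (f y)) x.
Proof.
move=> /differentiable_mxP df; apply: differentiable_fun_sum => s.
apply: (@differentiableM _ _ (cst _)); first exact: differentiable_cst.
by apply: differentiable_fun_prod => i; exact: df.
Qed.

(** Only near [x] is [invmx (f y)] given by the formula with the adjugate:
    at a singular matrix [invmx] is the identity. *)
Lemma differentiable_invmx n (f : V -> 'M[K]_n) x :
  differentiable f x -> f x \in unitmx ->
  differentiable (fun y => invmx (f y)) x.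
Proof.
move=> df; rewrite unitmxE unitfE => fx.
have /differentiable_mxP dfc := df.
have dG : differentiable (fun y => (\det (f y))^-1 *: \adj (f y)) x.
  apply/differentiable_mxP => i j; under eq_fun do rewrite !mxE.
  apply: differentiableM; first exact: differentiableV (differentiable_det df) fx.
  apply: (@differentiableM _ _ (cst _)); first exact: differentiable_cst.
  apply: differentiable_det; apply/differentiable_mxP => k l.
  by under eq_fun do rewrite !mxE; exact: dfc.
apply: near_eq_differentiable dG.
have dc := differentiable_continuous (differentiable_det df).
apply: filterS (cvgr_neq0 _ dc fx) => y fy.
by rewrite /invmx unitmxE unitfE fy.
Qed.

Lemma near_unitmx n (f : V -> 'M[K]_n) x :
  differentiable f x -> f x \in unitmx -> \near x, f x \in unitmx.
Proof.
move=> df; rewrite unitmxE unitfE => fx.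
have dc := differentiable_continuous (differentiable_det df).
apply: filterS (cvgr_neq0 _ dc fx) => y fy.
by rewrite unitmxE unitfE.
Qed.

Lemma derive_linear p q (f : V -> 'M[K]_(p, q)) x a v w :
  differentiable f x -> 'D_(v - a *: w) f x = 'D_v f x - a *: 'D_w f x.
Proof. by move=> df; rewrite !deriveE // linearB linearZ. Qed.

Lemma differentiable_col_mx p1 p2 q (f : V -> 'M[K]_(p1, q))
    (g : V -> 'M[K]_(p2, q)) x :
  differentiable f x -> differentiable g x ->
  differentiable (fun y => col_mx (f y) (g y)) x.
Proof.
move=> /differentiable_mxP df /differentiable_mxP dg.
apply/differentiable_mxP => i j; under eq_fun do rewrite mxE.
by case: (fintype.split i).
Qed.

Lemma derive_col_mx p1 p2 q (f : V -> 'M[K]_(p1, q))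
    (g : V -> 'M[K]_(p2, q)) x v :
  differentiable f x -> differentiable g x ->
  'D_v (fun y => col_mx (f y) (g y)) x = col_mx ('D_v f x) ('D_v g x).
Proof.
move=> df dg; apply/matrixP => i j.
refine (eq_trans (esym (derive_coord _ _ _ (differentiable_col_mx df dg))) _).
under eq_fun do rewrite mxE; rewrite mxE.
by case: (fintype.split i) => i'; exact: derive_coord.
Qed.

Lemma differentiable_row p q (f : V -> 'M[K]_(p, q)) x i :
  differentiable f x -> differentiable (fun y => row i (f y)) x.
Proof.
move=> df; under eq_fun do rewrite rowE.
by apply: differentiable_mulmx => //; exact: differentiable_mxcst.
Qed.

Lemma differentiable_usubmx m1 m2 n (f : V -> 'M[K]_(m1 + m2, n)) x :
  differentiable f x -> differentiable (fun y => usubmx (f y)) x.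
Proof.
move=> /differentiable_mxP df; apply/differentiable_mxP => i j.
by under eq_fun do rewrite mxE.
Qed.

Lemma derive_usubmx m1 m2 n (f : V -> 'M[K]_(m1 + m2, n)) x v :
  differentiable f x -> 'D_v (fun y => usubmx (f y)) x = usubmx ('D_v f x).
Proof.
move=> df; apply/matrixP => i j.
refine (eq_trans (esym (derive_coord _ _ _ (differentiable_usubmx df))) _).
rewrite [RHS]mxE -(derive_coord _ _ _ df).
by congr (derive _ x v); apply/funext => z; rewrite mxE.
Qed.

Lemma derive_in_subspace p q N
    (f : V -> 'M[K]_(p, N)) (P : 'M[K]_(q, N)) y v :
  differentiable f y -> (\forall z \near y, (f z <= P)%MS) -> ('D_v f y <= P)%MS.
Proof.
move=> df fP; rewrite submxE -(derive_mulmxr _ _ df).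
have E : \forall z \near y, f z *m cokermx P = cst 0 z.
  by apply: filterS fP => z; rewrite submxE => /eqP.
by rewrite (near_eq_derive _ E) derive_cst.
Qed.

(** The zero added in the formula for the derivative puts it in the same
    affine form as [g] itself, so that the lemma can be iterated. *)
Lemma differentiable_affine p q p' q'
    (f : V -> 'M[K]_(p, q)) (g : V -> 'M[K]_(p', q'))
    (E : 'M[K]_(p', p)) (B : 'M[K]_(q, q')) (D : 'M[K]_(p', q')) x :
  differentiable f x -> (\forall y \near x, g y = E *m f y *m B + D) ->
  differentiable g x /\ forall v, 'D_v g x = E *m 'D_v f x *m B + 0.
Proof.
move=> df gE.
have dEf : differentiable (fun y => E *m f y) x.
  by apply: differentiable_mulmx => //; exact: differentiable_mxcst.
have dEfB : differentiable (fun y => E *m f y *m B) x.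
  by apply: differentiable_mulmx => //; exact: differentiable_mxcst.
have dD : differentiable (cst D : V -> _) x by exact: differentiable_cst.
have dh := differentiableD dEfB dD.
have gE' : \forall y \near x, ((fun y => E *m f y *m B) + cst D) y = g y.
  by apply: filterS gE => y ->.
split=> [|v]; first exact: near_eq_differentiable gE' dh.
rewrite -(near_eq_derive _ gE') deriveD; [|exact: diff_derivable..].
by rewrite derive_mulmxr // derive_mulmxl // derive_cst.
Qed.

End MatrixCalculus.

(** * Complex derivatives along real lines *)

Section RealLines.
Context {R : realType}.
Local Notation C := (R[i]).
Context {V : normedModType C}.
Implicit Types (x v w : V).

(** The norm of [V] takes its values in [C]. *)
Local Notation rn v := (complex.Re `|v|).

Lemma Re_normE (W : normedModType C) (v : W) : (rn v)%:C%C = `|v|.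
Proof. by rewrite RRe_real // normr_real. Qed.

Lemma norm_real_complex (t : R) : `|t%:C%C : C| = `|t|%:C%C.
Proof. by rewrite normc_def /= expr0n /= addr0 sqrtr_sqr. Qed.

Lemma normRe_le (z : C) : `|complex.Re z|%:C%C <= `|z|.
Proof.
rewrite normc_def lecR -sqrtr_sqr ler_wsqrtr // lerDl; exact: sqr_ge0.
Qed.

Lemma gt0_complex_real (d : C) : 0 < d -> d = (complex.Re d)%:C%C /\ 0 < complex.Re d.
Proof.
move=> d0; have dE : d = (complex.Re d)%:C%C by rewrite RRe_real // gtr0_real.
by split=> //; rewrite -ltcR -dE.
Qed.

Lemma ReB (z1 z2 : C) : complex.Re (z1 - z2) = complex.Re z1 - complex.Re z2.
Proof. by case: z1 z2 => [a b] [c d]. Qed.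

Lemma ReZ (h : R) (z : C^o) :
  complex.Re (h%:C%C *: z : C) = h * complex.Re (z : C).
Proof. by case: z => a b /=; rewrite mul0r subr0. Qed.

(** Restricting to a real line and taking real parts turns a complex derivative
    into a real one, to which the mean value theorem applies; the imaginary part
    is recovered from the real part of the product by i. *)
Lemma is_derive_Re_line (g : V -> C^o) x v (s : R) :
  differentiable g (x + s%:C%C *: v) ->
  is_derive s (1 : R) (fun t : R => complex.Re (g (x + t%:C%C *: v)))
    (complex.Re ('D_v g (x + s%:C%C *: v))).
Proof.
move=> dg; set y := x + _.
have cg : (fun h : C => h^-1 *: (g (h *: v + y) - g y)) @ 0^' --> ('D_v g y : C^o).
  have : derivable g y v by exact: diff_derivable.
  by rewrite /derivable; apply: cvg_trans.
suff cR : (fun h : R => h^-1 *: (complex.Re (g (x + (h *: 1 + s)%:C%C *: v)) -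
     complex.Re (g y))) @ 0^' --> complex.Re ('D_v g y).
  by apply: DeriveDef; [apply/cvg_ex; eexists; exact: cR | exact: cvg_lim cR].
apply/cvgrPdist_le => e e0.
have e0' : 0 < e%:C%C by rewrite ltcR.
move/cvgrPdist_le: cg => /(_ _ e0').
rewrite !near_withinE => /nbhs_ballP[d /= /gt0_complex_real[dE d0] H].
apply/nbhs_ballP; exists (complex.Re d) => // h /= hd0 h0.
have hd : (`|0 - h%:C%C : C| < d).
  by move: hd0; rewrite -ball_normE /= sub0r !normrN dE => hd0; rewrite sub0r normrN norm_real_complex ltcR.
have hn0 : h%:C%C != 0 by rewrite -(rmorph0 (real_complex R)) (inj_eq (@complexI _)).
move: (H _ hd hn0); rewrite -lecR; apply: le_trans.
apply: le_trans (normRe_le _); rewrite lecR.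
have -> : x + (h *: 1 + s)%:C%C *: v = h%:C%C *: v + y.
  by rewrite /y addrCA -scalerDl -rmorphD [h *: 1]mulr1.
by rewrite ReB -fmorphV ReZ ReB.
Qed.

Lemma MVT_Re_line (g : V -> C^o) x v (t : R) : 0 < t ->
  (forall s : R, 0 <= s <= t -> differentiable g (x + s%:C%C *: v)) ->
  exists2 s : R, 0 < s < t &
  complex.Re (g (x + t%:C%C *: v) - g x) =
  t * complex.Re ('D_v g (x + s%:C%C *: v)).
Proof.
move=> t0 dg.
pose f (s : R) := complex.Re (g (x + s%:C%C *: v)).
pose df (s : R) := complex.Re ('D_v g (x + s%:C%C *: v)).
have dfE s : 0 <= s <= t -> is_derive s (1 : R) f (df s).
  by move=> /dg; exact: is_derive_Re_line.
have := @MVT R f df 0 t t0; case.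
- by move=> s; rewrite in_itv /= => /andP[/ltW ? /ltW ?]; apply: dfE; apply/andP.
- apply: derivable_within_continuous => s; rewrite in_itv /= => /dfE dfs.
  exact: ex_derive.
- move=> s; rewrite in_itv /= => sI; rewrite subr0 => H; exists s => //.
  by rewrite ReB mulrC -H /f /= scale0r addr0.
Qed.

Lemma MVT_Re_parallel_lines (g : V -> C^o) x1 x0 v (t : R) : 0 < t ->
  (forall s : R, 0 <= s <= t -> differentiable g (x1 + s%:C%C *: v) /\
     differentiable g (x0 + s%:C%C *: v)) ->
  exists2 s : R, 0 < s < t &
  complex.Re (g (x1 + t%:C%C *: v) - g x1 - (g (x0 + t%:C%C *: v) - g x0)) =
  t * complex.Re ('D_v g (x1 + s%:C%C *: v) - 'D_v g (x0 + s%:C%C *: v)).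
Proof.
move=> t0 dg.
pose f1 (s : R) := complex.Re (g (x1 + s%:C%C *: v)).
pose f0 (s : R) := complex.Re (g (x0 + s%:C%C *: v)).
pose df (s : R) := complex.Re ('D_v g (x1 + s%:C%C *: v)) -
  complex.Re ('D_v g (x0 + s%:C%C *: v)).
have dfE s : 0 <= s <= t -> is_derive s (1 : R) (f1 - f0) (df s).
  by move=> /dg[d1 d0]; apply: is_deriveB; exact: is_derive_Re_line.
have := @MVT R (f1 - f0) df 0 t t0; case.
- by move=> s; rewrite in_itv /= => /andP[/ltW ? /ltW ?]; apply: dfE; apply/andP.
- apply: derivable_within_continuous => s; rewrite in_itv /= => /dfE dfs.
  exact: ex_derive.
- move=> s; rewrite in_itv /= => sI; rewrite subr0 => H; exists s => //.
  have {}H : (f1 t - f0 t) - (f1 0 - f0 0) = t * df s by rewrite mulrC -H.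
  rewrite [in RHS]ReB -/(df s) -H /f1 /f0 !scale0r !addr0 !ReB.
  by rewrite !opprD !opprK addrACA.
Qed.

Lemma dist_le_of_common_approx (D k a b e : R) : 0 < k ->
  `|D - k * a| <= e / 2 * k -> `|D - k * b| <= e / 2 * k -> `|a - b| <= e.
Proof.
move=> k0 E1 E2; rewrite -(ler_pM2l k0) -(gtr0_norm k0) -normrM (gtr0_norm k0).
have -> : k * (a - b) = (D - k * b) - (D - k * a) by ring.
apply: le_trans (ler_normB _ _) _; apply: le_trans (lerD E2 E1) _.
by rewrite -mulrDl -splitr mulrC.
Qed.

(** The mean value theorem in the direction [v] turns the second difference
    into the increment of ['D_v g] over [t *: w], which the differentiability of
    ['D_v g] at [x] evaluates.  The second difference is symmetric in [v] and
    [w], hence so is the second derivative. *)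
Lemma second_difference_approx (g : V -> C^o) x v w (e : R) :
  (\near x, differentiable g x) -> differentiable ('D_v g : V -> C^o) x -> 0 < e ->
  exists2 d : R, 0 < d & forall t : R, 0 < t < d ->
    `|complex.Re (g (x + t%:C%C *: w + t%:C%C *: v) - g (x + t%:C%C *: w)
                - (g (x + t%:C%C *: v) - g x))
      - t ^+ 2 * complex.Re ('D_w ('D_v g : V -> C^o) x)| <= e * t ^+ 2.
Proof.
move=> dg ddg e0.
set h : V -> C^o := 'D_v g in ddg *.
(* the increment joins two points at distance at most t N from x, so that the
   error is at most (e / B) * (2 t N) <= e t *)
pose N := rn v + rn w; pose B := N + N + 1.
have rn0 (W : normedModType C) (u : W) : 0 <= rn u.
  by rewrite -lecR Re_normE normr_ge0.
have N0 : 0 <= N by apply: addr_ge0; exact: rn0.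
have B0 : 0 < B by apply: ltr_wpDl => //; apply: addr_ge0.
have NB : N < B by rewrite /B -addrA ltrDl ltr_wpDl.
have eB : 0 < (e / B)%:C%C by rewrite ltcR divr_gt0.
have := differentiable_littleo ddg eB.
move/(filterI dg) => /nbhs_normP[d /= /gt0_complex_real[dE d0] H].
exists (complex.Re d / B); first by rewrite divr_gt0.
move=> t /andP[t0 td].
have tB : t * B < complex.Re d by rewrite -ltr_pdivlMr.
have norm_small (s1 s2 : R) : 0 <= s1 <= t -> 0 <= s2 <= t ->
    `|s1%:C%C *: v + s2%:C%C *: w| <= (t * N)%:C%C.
  move=> /andP[s10 s1t] /andP[s20 s2t].
  apply: le_trans (ler_normD _ _) _; rewrite !normrZ !norm_real_complex !ger0_norm //.
  rewrite -(Re_normE v) -(Re_normE w) -!rmorphM -rmorphD lecR mulrDr.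
  by apply: lerD; apply: ler_wpM2r.
have Hs (s1 s2 : R) : 0 <= s1 <= t -> 0 <= s2 <= t ->
    differentiable g (x + (s1%:C%C *: v + s2%:C%C *: w)) /\
    `|h (x + (s1%:C%C *: v + s2%:C%C *: w)) - h x -
      'd h x (s1%:C%C *: v + s2%:C%C *: w)| <= ((e / B) * (t * N))%:C%C.
  move=> hs1 hs2; have := norm_small _ _ hs1 hs2; set u := _ + _ => hu.
  have [|du] := H (x + u).
    rewrite /= opprD addNKr normrN dE; apply: le_lt_trans hu _; rewrite ltcR.
    by apply: lt_trans tB; rewrite ltr_pM2l.
  have -> : x + u - x = u by rewrite addrAC subrr add0r.
  move=> hle; split=> //; apply: le_trans hle _.
  by rewrite (rmorphM _ (e / B)) ler_pM2l.
have t0t : 0 <= t <= t by rewrite lexx ltW.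
have z0t : 0 <= (0 : R) <= t by rewrite lexx ltW.
have [|s sI ->] := @MVT_Re_parallel_lines g (x + t%:C%C *: w) x v t t0.
  move=> s sI; split.
    by have [+ _] := Hs s t sI t0t; rewrite -addrA [_ *: w + _]addrC.
  by have [+ _] := Hs s 0 sI z0t; rewrite scale0r addr0.
have {}sI : 0 <= s <= t by case/andP: sI => /ltW -> /ltW ->.
have [_ E1] := Hs s t sI t0t; have [_ E0] := Hs s 0 sI z0t.
rewrite -/h expr2 -mulrA -mulrBr normrM (gtr0_norm t0) mulrCA ler_pM2l // -ReZ -ReB.
rewrite -lecR; apply: le_trans (normRe_le _) _.
have -> : x + t%:C%C *: w + s%:C%C *: v = x + (s%:C%C *: v + t%:C%C *: w).
  by rewrite -addrA; congr (_ + _); rewrite addrC.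
have -> : x + s%:C%C *: v = x + (s%:C%C *: v + 0%:C%C *: w).
  by rewrite scale0r addr0.
set a := h _ in E1 *; set b := h _ in E0 *.
have -> : t%:C%C *: 'D_w h x = 'd h x (s%:C%C *: v + t%:C%C *: w) -
    'd h x (s%:C%C *: v + 0%:C%C *: w) :> C^o.
  by rewrite -linearB /= opprD addrACA subrr add0r scale0r subr0 linearZ deriveE.
set a' := 'd h x _ in E1 *; set b' := 'd h x _ in E0 *.
have -> : a - b - (a' - b') = (a - h x - a') - (b - h x - b').
  rewrite [in RHS]opprD [in LHS]opprD [RHS]addrACA; congr (_ + _).
  by rewrite opprB addrA subrK.
apply: le_trans (ler_normB _ _) _; apply: le_trans (lerD E1 E0) _.
rewrite -rmorphD lecR -mulrDr -mulrDr mulrAC -mulrA.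
by rewrite ler_pM2l // ler_pdivrMr // ler_pM2l // /B lerDl.
Qed.

Lemma eq_complex_Re (z1 z2 : C) :
  complex.Re z1 = complex.Re z2 ->
  complex.Re ('i%C * z1) = complex.Re ('i%C * z2) -> z1 = z2.
Proof.
by case: z1 z2 => [a b] [c d] /= ->; rewrite !mul0r !mul1r !sub0r => /oppr_inj ->.
Qed.

Lemma derive_swap_Re (g : V -> C^o) x v w :
  (\near x, differentiable g x) ->
  differentiable ('D_v g : V -> C^o) x -> differentiable ('D_w g : V -> C^o) x ->
  complex.Re ('D_w ('D_v g : V -> C^o) x) = complex.Re ('D_v ('D_w g : V -> C^o) x).
Proof.
move=> dg dv dw; apply/eqP; rewrite -subr_eq0 -normr_le0; apply/ler_addgt0Pr => e e0.
rewrite add0r; have e2 : 0 < e / 2 by rewrite divr_gt0.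
have [d1 d10 H1] := second_difference_approx w dg dv e2.
have [d2 d20 H2] := second_difference_approx v dg dw e2.
pose t := Num.min d1 d2 / 2.
have m0 : 0 < Num.min d1 d2 by rewrite lt_min d10.
have t0 : 0 < t by rewrite divr_gt0.
have tm : t < Num.min d1 d2 by rewrite ltr_pdivrMr // ltr_pMr // ltr1n.
have t1 : t < d1 by apply: lt_le_trans tm _; rewrite ge_min lexx.
have t2 : t < d2 by apply: lt_le_trans tm _; rewrite ge_min lexx orbT.
have {}H1 := H1 t; have {}H2 := H2 t.
rewrite t0 t1 in H1; rewrite t0 t2 in H2.
move: (H1 isT) (H2 isT).
set p := g (x + _ + _); set q := g (x + _ + _).
have -> : q = p by rewrite /q addrAC.
set D := complex.Re (p - _ - _); set D' := complex.Re (p - _ - _).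
have -> : D' = D.
  by rewrite /D' /D; congr complex.Re; rewrite !opprB !addrA addrAC [in RHS]addrAC; congr (_ + _); rewrite addrAC.
have k0 : 0 < t ^+ 2 by rewrite exprn_gt0.
exact: dist_le_of_common_approx k0.
Qed.

Lemma derive_swap (g : V -> C^o) x v w :
  (\near x, differentiable g x) ->
  differentiable ('D_v g : V -> C^o) x -> differentiable ('D_w g : V -> C^o) x ->
  'D_w ('D_v g : V -> C^o) x = 'D_v ('D_w g : V -> C^o) x.
Proof.
move=> dg dv dw; have E := derive_swap_Re dg dv dw.
refine (eq_complex_Re E _) => {E}.
pose ig : V -> C^o := 'i%C \*: g.
have dig : \near x, differentiable ig x.
  by apply: filterS dg => y dy; exact: differentiableZ.
have Dig u : \forall y \near x, ('i%C \*: ('D_u g : V -> C^o)) y = 'D_u ig y.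
  by apply: filterS dg => y dy; rewrite /ig deriveZ //; exact: diff_derivable.
have dDig u : differentiable ('D_u g : V -> C^o) x ->
    differentiable ('D_u ig : V -> C^o) x.
  by move=> du; apply: near_eq_differentiable (Dig u) _; exact: differentiableZ.
have DD u u' : differentiable ('D_u g : V -> C^o) x ->
    'D_u' ('D_u ig : V -> C^o) x = 'i%C * 'D_u' ('D_u g : V -> C^o) x.
  move=> du; have E := near_eq_derive u' (Dig u).
  have dD : derivable ('D_u g : V -> C^o) x u' by exact: diff_derivable.
  refine (eq_trans (esym E) _).
  exact: (deriveZ 'i%C dD).
have E := derive_swap_Re dig (dDig _ dv) (dDig _ dw).
exact: (eq_trans (f_equal _ (esym (DD _ _ dv))) (eq_trans E (f_equal _ (DD _ _ dw)))).
Qed.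

Lemma derive0_line (g : V -> C^o) x v :
  (forall s : R, 0 <= s <= 1 -> differentiable g (x + s%:C%C *: v)) ->
  (forall s : R, 0 <= s <= 1 -> 'D_v g (x + s%:C%C *: v) = 0) ->
  g (x + v) = g x.
Proof.
move=> dg Dg.
have key (f : V -> C^o) :
    (forall s : R, 0 <= s <= 1 -> differentiable f (x + s%:C%C *: v)) ->
    (forall s : R, 0 <= s <= 1 -> 'D_v f (x + s%:C%C *: v) = 0) ->
    complex.Re (f (x + v)) = complex.Re (f x).
  move=> df Df; have [|s /andP[/ltW s0 /ltW s1]] := @MVT_Re_line f x v 1 ltr01.
    exact: df.
  rewrite Df ?s0 // mulr0 scale1r ReB => /eqP; rewrite subr_eq0 => /eqP //.
apply: eq_complex_Re; first exact: key.
apply: (key ('i%C \*: g)) => s s01.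
  exact/differentiableZ/dg.
rewrite deriveZ; last exact/diff_derivable/dg.
by rewrite Dg // scaler0.
Qed.

Lemma derive_swap_mx p q (f : V -> 'M[C]_(p, q)) x v w :
  (\near x, differentiable f x) ->
  differentiable ('D_v f) x -> differentiable ('D_w f) x ->
  'D_w ('D_v f) x = 'D_v ('D_w f) x.
Proof.
move=> df dv dw; apply/matrixP => i j.
have E u : \forall y \near x, 'D_u f y i j = 'D_u (fun y => f y i j : C^o) y.
  by apply: filterS df => y dy; rewrite derive_coord.
have dE u : differentiable ('D_u f) x ->
    differentiable ('D_u (fun y => f y i j : C^o) : V -> C^o) x.
  by move=> du; apply: near_eq_differentiable (E u) _; exact: differentiable_mx_coord.
have dfc : \near x, differentiable (fun y => f y i j : C^o) x.
  by apply: filterS df => y; exact: differentiable_mx_coord.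
have sw := derive_swap dfc (dE _ dv) (dE _ dw).
refine (eq_trans (esym (derive_coord _ _ _ dv)) _).
refine (eq_trans (near_eq_derive _ (E v)) (eq_trans sw _)).
refine (eq_trans (esym (near_eq_derive _ (E w))) _).
exact: derive_coord.
Qed.

Lemma derive0_cst_ball p q (f : V -> 'M[C]_(p, q)) x (d : C) :
  (forall y, ball x d y -> differentiable f y) ->
  (forall y v, ball x d y -> 'D_v f y = 0) ->
  forall y, ball x d y -> f y = f x.
Proof.
move=> df Df y xy; apply/matrixP => i j.
rewrite -[y](subrK x) addrC.
have xs (s : R) : 0 <= s <= 1 -> ball x d (x + s%:C%C *: (y - x)).
  move=> /andP[s0 s1]; move: xy; rewrite -!ball_normE /= => xy.
  rewrite opprD addNKr normrN normrZ norm_real_complex ger0_norm //.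
  apply: le_lt_trans xy; rewrite distrC ler_piMl //.
  by rewrite lecR.
apply: (@derive0_line (fun y => f y i j : C^o)) => s /xs xsy.
  by move/differentiable_mxP: (df _ xsy).
by rewrite derive_coord ?Df ?mxE //; exact: df.
Qed.

End RealLines.

(** * Matrices and row spaces *)

Lemma outer_product_eq (F : fieldType) k N (a b : 'cV[F]_k) (c d : 'rV[F]_N) j :
  a *m c = b *m d -> c 0 j != 0 -> a = (d 0 j / c 0 j) *: b.
Proof.
move=> /matrixP E cj; apply/matrixP => i z; rewrite [z]ord1 !mxE.
have := E i j; rewrite !mxE !big_ord1 => {}E.
by apply: (mulIf cj); rewrite E mulrAC divfK // mulrC.
Qed.

Lemma noncollinear_vector (F : fieldType) r (s : 'rV[F]_r) : (2 <= r)%N ->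
  exists v : 'rV[F]_r, forall c, v != c *: s.
Proof.
move=> r2; have : ~~ ((1%:M : 'M[F]_r) <= s)%MS.
  apply/negP => /mxrankS; rewrite mxrank1 => rs.
  by have := leq_trans r2 (leq_trans rs (rank_leq_row s)).
move=> /row_subPn[i ns]; exists (row i 1%:M) => a.
by apply: contraNneq ns => ->; exact: scalemx_sub.
Qed.

Lemma usubmx_row_free (F : fieldType) p q (A : 'M[F]_(p + q)) :
  A \in unitmx -> row_free (usubmx A).
Proof.
move=> Au; apply/row_freeP; exists (invmx A *m col_mx 1%:M 0).
rewrite mulmxA mul_usub_mx mulmxV //.
by rewrite mul_usub_mx mul1mx col_mxKu.
Qed.

Lemma row_free_same_rank_sub (F : fieldType) p q N (W : 'M[F]_(q, N)) (P : 'M[F]_(p, N)) :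
  (p <= \rank W)%N -> (W <= P)%MS -> (P <= W)%MS.
Proof.
move=> pW WP; rewrite -(geq_leqif (mxrank_leqif_sup WP)).
exact: leq_trans (rank_leq_row P) pW.
Qed.

Lemma row_freeMl (F : fieldType) k n p (A : 'M[F]_(k, n)) (B : 'M[F]_(n, p)) :
  row_free (A *m B) -> row_free A.
Proof. by move=> /row_freeP[Z ABZ]; apply/row_freeP; exists (B *m Z); rewrite mulmxA. Qed.

Lemma row_freeM (F : fieldType) k n p (A : 'M[F]_(k, n)) (B : 'M[F]_(n, p)) :
  row_free A -> row_free B -> row_free (A *m B).
Proof.
move=> /row_freeP[Z AZ] /row_freeP[Y BY]; apply/row_freeP; exists (Y *m Z).
by rewrite mulmxA -(mulmxA A) BY mulmx1.
Qed.

Lemma row_free_complete (F : fieldType) k j (B : 'M[F]_(k, k + j)) :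
  row_free B -> exists E : 'M[F]_(j, k + j), col_mx B E \in unitmx.
Proof.
move=> Bfree; exists (row_mx 0 1%:M *m row_ebase B).
have BE : B = row_mx (col_ebase B) 0 *m row_ebase B.
  rewrite -{1}(mulmx_ebase B) (eqP Bfree).
  have -> : pid_mx k = row_mx 1%:M 0 :> 'M[F]_(k, k + j).
    by rewrite -pid_mx_row.
  by rewrite mul_mx_row mulmx1 mulmx0.
rewrite {1}BE -mul_col_mx unitmx_mul row_ebase_unit andbT.
by rewrite -/(block_mx _ _ _ _) unitmxE det_ublock det1 mulr1 -unitmxE col_ebase_unit.
Qed.

(** If [A *m Z = 1] then [(s *: A + B) *m Z] is invertible as soon as [s] is
    not an eigenvalue of [- B *m Z], and a polynomial has finitely many roots. *)
Lemma row_free_perturb (F : numFieldType) p n (A B : 'M[F]_(p, n)) :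
  row_free A -> exists2 t, t != 0 & row_free (A + t *: B).
Proof.
move=> /row_freeP[Z AZ].
pose K := B *m Z; pose f := char_poly (- K).
have f0 : f != 0 by exact/monic_neq0/char_poly_monic.
pose rs : seq F := [seq i.+1%:R | i <- iota 0 (size f)].
have urs : uniq rs.
  rewrite map_inj_uniq ?iota_uniq // => i j /eqP; rewrite eqr_nat => /eqP [].
  by [].
have /allPn[s /mapP[i _ si] fs] : ~~ all (root f) rs.
  apply/negP => /(max_poly_roots f0)/(_ urs).
  by rewrite size_map size_iota ltnn.
have s0 : s != 0 by rewrite si pnatr_eq0.
exists s^-1; first by rewrite invr_eq0.
have sK : s%:M + K \in unitmx.
  rewrite -row_free_unit -kermx_eq0; apply: contraNT fs => /rowV0Pn[v].
  rewrite sub_kermx => /eqP vK v0.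
  rewrite -eigenvalue_root_char; apply/eigenvalueP; exists v => //.
  move: vK; rewrite mulmxDr mul_mx_scalar mulmxN => /eqP.
  by rewrite addr_eq0 => /eqP ->.
apply/row_freeP; exists (Z *m invmx (s%:M + K) *m s%:M).
have -> : A + s^-1 *: B = s^-1 *: (s *: A + B) by rewrite scalerDr scalerA mulVf ?scale1r.
rewrite -scalemxAl !mulmxA mulmxDl -scalemxAl AZ -/K scalemx1 mulmxV //.
by rewrite mul1mx scale_scalar_mx mulVf.
Qed.

(** The matrices [tg x] stand for the tangent subspaces of a submanifold at
    the points [x] of a generator.  Being of full rank is an open dense condition
    on [x], and the derivatives of the generator depend linearly on [x]: they
    are tangent everywhere as soon as they are tangent at the points of full
    rank. *)
Lemma generic_tangent (K : numFieldType) k r N n (A0 : 'M[K]_(k, N))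
    (D : 'I_r -> 'M[K]_(k, N)) (T : 'M[K]_(n, N)) :
  let tg (x : 'rV[K]_k) := col_mx A0 (\matrix_(q < r) (x *m D q)) in
  (exists x, row_free (tg x)) -> (forall x, row_free (tg x) -> (tg x <= T)%MS) ->
  forall q, (D q <= T)%MS.
Proof.
move=> tg [x0 x0free] tgT q; apply/row_subP => i; rewrite rowE.
set x : 'rV_k := delta_mx 0 i.
pose B := col_mx (0 : 'M[K]_(k, N)) (\matrix_(q < r) (x *m D q)).
have [t t0 tfree] := row_free_perturb B x0free.
have tE : tg x0 + t *: B = tg (x0 + t *: x).
  rewrite /tg /B scale_col_mx scaler0 add_col_mx addr0; congr col_mx.
  by apply/row_matrixP => s; rewrite linearD linearZ /= !rowK mulmxDl -scalemxAl.
have tBT : (((tg x0 + t *: B)%R - tg x0)%R <= T)%MS.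
  by apply: addmx_sub; [rewrite tE; apply: tgT; rewrite -tE | rewrite eqmx_opp; apply: tgT].
rewrite [(_ + _)%R]addrC addKr in tBT.
have : (B <= T)%MS by rewrite -(eqmx_scale B t0).
rewrite /B -addsmxE addsmx_sub => /andP[_] /row_subP/(_ q).
by rewrite rowK.
Qed.

Lemma closed_eigenvalue (F : closedFieldType) r (A : 'M[F]_r) :
  (0 < r)%N -> exists a, eigenvalue A a.
Proof.
move=> r0; have /closed_rootP[a ra] : size (char_poly A) != 1.
  by rewrite size_char_poly -lt0n in r0 *; case: r r0 A.
by exists a; rewrite eigenvalue_root_char.
Qed.

(** * Irreducibility of the focus polynomial *)

Lemma mpoly_irreducible_factor (K : fieldType) n (p : mpoly n K) :
  (1 < msize p)%N ->
  exists q s, [/\ p = q * s, (1 < msize q)%N &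
    forall g h, q = g * h -> (msize g <= 1)%N \/ (msize h <= 1)%N].
Proof.
have [N] := ubnP (msize p); elim: N p => // N IHN p pN p1.
have [red|irr] := pselect (exists g h,
    [/\ p = g * h, (1 < msize g)%N & (1 < msize h)%N]); last first.
  exists p, 1; split; rewrite ?mulr1 // => g h pgh.
  have [g1|g1] := leqP (msize g) 1; first by left.
  have [h1|h1] := leqP (msize h) 1; first by right.
  by case: irr; exists g, h.
have [g [h [pgh g1 h1]]] := red.
have g0 : g != 0 by rewrite -msize_poly_eq0 -lt0n ltnW.
have h0 : h != 0 by rewrite -msize_poly_eq0 -lt0n ltnW.
have gN : (msize g < N)%N.
  have := pN; rewrite pgh (msizeM g0 h0) ltnS; apply: leq_trans.
  by rewrite -[in X in (_ < X)%N]subn1 ltn_subRL addnC ltn_add2l.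
have [q [s [gqs q1 qirr]]] := IHN g gN g1.
by exists q, (s * h); split=> //; rewrite mulrA -gqs.
Qed.

Lemma scaled_square_factor (K : comNzRingType) (A : comAlgType K) (a b : K) (x s t : A) :
  (a *: x * s) * (b *: x * t) = x ^+ 2 * ((a *: s) * (b *: t)).
Proof. by rewrite -!scalerAl -!scalerAr !scalerA mulrACA expr2 mulrC. Qed.

(** In a product of two nonconstant factors, irreducible factors of both are
    multiples of the only component [G], so that [G ^+ 2] divides [p]. *)
Lemma indecomposable_irreducible (R : realType) n (p : mpoly n R[i]) :
  no_multiple_components p -> indecomposable p ->
  forall g h, p = g * h -> (msize g <= 1)%N \/ (msize h <= 1)%N.
Proof.
move=> mult [G compG uniqG] g h pgh.
have [g1|g1] := leqP (msize g) 1; first by left.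
have [h1|h1] := leqP (msize h) 1; first by right.
have [q1 [s1 [gq q11 qirr1]]] := mpoly_irreducible_factor g1.
have [q2 [s2 [hq q21 qirr2]]] := mpoly_irreducible_factor h1.
have [a qa] : exists a, q1 = a *: G.
  by apply: uniqG; split=> //; exists (s1 * h); rewrite mulrA -gq.
have [b qb] : exists b, q2 = b *: G.
  by apply: uniqG; split=> //; exists (s2 * g); rewrite mulrA -hq mulrC.
case: (mult G compG); exists ((a *: s1) * (b *: s2)).
by rewrite pgh gq hq qa qb scaled_square_factor.
Qed.

Section Pencils.
Context {F : fieldType} {k : nat}.
Local Notation P := (mpoly k F).

Definition pencil p q (D : 'I_k -> 'M[F]_(p, q)) : 'M[P]_(p, q) :=
  \matrix_(i, j) \sum_(s < k) D s i j *: mpolyX F (mnm1 s).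

Lemma pencil_mulmxl p q s (A : 'M[F]_(p, q)) (D : 'I_k -> 'M[F]_(q, s)) :
  pencil (fun i => A *m D i) = map_mx (@mpolyC k F) A *m pencil D.
Proof.
apply/matrixP => i j; rewrite !mxE.
under eq_bigr do rewrite mxE scaler_suml.
rewrite exchange_big /=; apply: eq_bigr => t _; rewrite !mxE mulr_sumr.
by apply: eq_bigr => u _; rewrite mul_mpolyC scalerA.
Qed.

Lemma pencil_mulmxr p q s (A : 'M[F]_(q, s)) (D : 'I_k -> 'M[F]_(p, q)) :
  pencil (fun i => D i *m A) = pencil D *m map_mx (@mpolyC k F) A.
Proof.
apply/matrixP => i j; rewrite !mxE.
under eq_bigr do rewrite mxE scaler_suml.
rewrite exchange_big /=; apply: eq_bigr => t _; rewrite !mxE mulr_suml.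
by apply: eq_bigr => u _; rewrite [RHS]mulrC mul_mpolyC scalerA [in RHS]mulrC.
Qed.

Lemma eval_pencil p q (D : 'I_k -> 'M[F]_(p, q)) (v : 'I_k -> F) :
  map_mx (meval v) (pencil D) = \sum_s v s *: D s.
Proof.
apply/matrixP => i j; rewrite !mxE summxE raddf_sum /=.
by apply: eq_bigr => s _; rewrite mevalZ mevalXU !mxE mulrC.
Qed.

(** The determinant vanishes at 0 because [d] is positive, but not at [v]. *)
Lemma msize_det_pencil d (D : 'I_k -> 'M[F]_d) (v : 'I_k -> F) :
  (0 < d)%N -> \det (\sum_s v s *: D s) != 0 -> (1 < msize (\det (pencil D)))%N.
Proof.
move=> d0 Dv; rewrite ltnNge; apply: contra Dv => /msize1_polyC.
set c := mcoeff _ _ => E.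
have ev w : meval w (\det (pencil D)) = \det (\sum_s w s *: D s).
  by rewrite -det_map_mx eval_pencil.
rewrite -ev E mevalC.
have := ev (fun=> 0); rewrite E mevalC => -> {c E ev}.
rewrite big1 => [|s _]; last by rewrite scale0r.
by case: d d0 {D} => // d _; rewrite det0.
Qed.

(** The row space of [N] is invariant under all the [D i], so that in a basis
    adapted to it, the rows of [row_ebase N], the whole pencil is block
    triangular. *)
Lemma pencil_reducible r (D : 'I_k -> 'M[F]_r) (N : 'M[F]_r) (v : 'I_k -> F) :
  (forall i, N *m D i = D i *m N) -> N != 0 -> N \notin unitmx ->
  \det (\sum_s v s *: D s) != 0 ->
  exists G H : P, [/\ \det (pencil D) = G * H, (1 < msize G)%N & (1 < msize H)%N].
Proof.
move=> ND N0 Nu Dv.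
have [d1 [d2 [e rN d10 d20]]] : exists d1 d2,
    [/\ r = (d1 + d2)%N, \rank N = d1, (0 < d1)%N & (0 < d2)%N].
  exists (\rank N), (r - \rank N)%N; split=> //.
  - by rewrite subnKC // rank_leq_row.
  - by rewrite lt0n mxrank_eq0.
  - rewrite subn_gt0 ltn_neqAle rank_leq_row andbT.
    by move: Nu; rewrite -row_free_unit.
subst r; set Q := row_ebase N; set L := col_ebase N.
have Qu : Q \in unitmx by exact: row_ebase_unit.
have Lu : L \in unitmx by exact: col_ebase_unit.
(* the pencil in the basis Q, whose first d1 rows span the row space of N *)
pose E i := Q *m D i *m invmx Q.
have NE : N = L *m pid_mx d1 *m Q by have := mulmx_ebase N; rewrite rN.
have E0 i : ursubmx (E i) = 0.
  have : pid_mx d1 *m E i = invmx L *m D i *m L *m pid_mx d1.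
    have := ND i; rewrite {}NE => /(congr1 (fun X => invmx L *m X *m invmx Q)).
    by rewrite !mulmxA mulVmx // mul1mx mulmxK // /E !mulmxA.
  rewrite -[E i]submxK pid_mx_block; set Y := invmx L *m _ *m _.
  rewrite -[Y]submxK !mulmx_block !mul0mx !mul1mx !mulmx0 !addr0.
  by move=> /eq_block_mx[_ E0 _ _]; rewrite block_mxKur.
have Dv' (A : 'M[F]_(d1 + d2)) : \det A != 0 -> \det (Q *m A *m invmx Q) != 0.
  by rewrite !det_mulmx det_inv mulrAC divff ?mul1r // -unitfE -unitmxE.
have detE : \det (pencil D) = \det (pencil E).
  rewrite pencil_mulmxr pencil_mulmxl !det_mulmx mulrAC -det_mulmx -map_mxM.
  by rewrite mulmxV // map_mx1 det1 mul1r.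
have blockE : pencil E = block_mx (pencil (fun i => ulsubmx (E i))) 0
    (pencil (fun i => dlsubmx (E i))) (pencil (fun i => drsubmx (E i))).
  apply/matrixP => i j; rewrite -[pencil E]submxK; congr (fun_of_matrix _ i j).
  have sub0 : ursubmx (pencil E) = 0.
    apply/matrixP => a b; rewrite !mxE big1 // => s _.
    by have /matrixP/(_ a b) := E0 s; rewrite !mxE => ->; rewrite scale0r.
  rewrite sub0; congr block_mx; apply/matrixP => a b; rewrite !mxE;
    by apply: eq_bigr => s _; rewrite !mxE.
have sumE : \sum_s v s *: E s = Q *m (\sum_s v s *: D s) *m invmx Q.
  rewrite mulmx_sumr mulmx_suml; apply: eq_bigr => s _.
  by rewrite -scalemxAr -scalemxAl.
have := Dv' _ Dv; rewrite -sumE.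
have -> : \sum_s v s *: E s = block_mx (\sum_s v s *: ulsubmx (E s)) 0
   (\sum_s v s *: dlsubmx (E s)) (\sum_s v s *: drsubmx (E s)).
  rewrite -!eval_pencil blockE map_block_mx; congr block_mx.
  by rewrite map_mx0.
rewrite det_lblock mulf_eq0 negb_or => /andP[v1 v2].
exists (\det (pencil (fun i => ulsubmx (E i)))), (\det (pencil (fun i => drsubmx (E i)))).
split; last 2 first.
- exact: msize_det_pencil v1.
- exact: msize_det_pencil v2.
- by rewrite detE blockE det_lblock.
Qed.

End Pencils.

(** [D i] and [S] are self-adjoint for the symmetric form [h], and so are their
    products [S *m D i], since [h *m (S *m D i) = B1 *m C i] is symmetric: hence
    [S] commutes with all the [D i].  An eigenvalue of [S] then gives an
    invariant subspace, unless [S] is a scalar. *)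
Lemma second_forms_proportional (F : closedFieldType) k r
    (C : 'I_k -> 'M[F]_r) (B0 B1 : 'M[F]_r) i0 :
  (0 < r)%N ->
  (forall i, (B0 *m C i)^T = B0 *m C i) -> (forall i, (B1 *m C i)^T = B1 *m C i) ->
  B0 *m C i0 \in unitmx ->
  (forall G H, \det (pencil C) = G * H -> (msize G <= 1)%N \/ (msize H <= 1)%N) ->
  exists c, B1 = c *: B0.
Proof.
move=> r0 sym0 sym1; rewrite unitmx_mul => /andP[B0u Cu] irr.
set h := B0 *m C i0; have hu : h \in unitmx by rewrite unitmx_mul B0u.
pose D i := invmx (C i0) *m C i.
pose S := invmx h *m (B1 *m C i0).
have hT : h^T = h by exact: sym0.
have hD i : h *m D i = B0 *m C i by rewrite /h /D mulmxA mulmxK.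
have hS : h *m S = B1 *m C i0 by rewrite /S mulKVmx.
have hSD i : h *m S *m D i = B1 *m C i by rewrite hS /D mulmxA mulmxK.
have hDT i : (D i)^T *m h = h *m D i by rewrite -{1}hT -trmx_mul hD sym0.
have hST : S^T *m h = h *m S by rewrite -{1}hT -trmx_mul hS sym1.
have SD i : S *m D i = D i *m S.
  apply: (can_inj (mulKmx hu)).
  rewrite (mulmxA h S) hSD (mulmxA h (D i)) -hDT -(mulmxA _ h S) -hST.
  by rewrite (mulmxA _ _ h) -trmx_mul -{1}hT -trmx_mul (mulmxA h S) hSD sym1.
have [c cS] := closed_eigenvalue S r0.
exists c; pose N := S - c%:M.
have [N0|N0] := eqVneq N 0.
  move/eqP: N0; rewrite subr_eq0 => /eqP Sc; move: hS.
  rewrite Sc mul_mx_scalar /h scalemxAl => /(can_inj (mulmxK Cu)) <-.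
  by [].
have Nu : N \notin unitmx.
  rewrite -row_free_unit; case/eigenvalueP: cS => v vS v0.
  apply: contra v0 => /row_free_injr/(_ v 0); rewrite /N.
  by rewrite /= mulmxBr vS mul_mx_scalar subrr mul0mx => /(_ erefl) ->.
have ND i : N *m D i = D i *m N.
  by rewrite /N mulmxBl mulmxBr SD mul_scalar_mx mul_mx_scalar.
(* at this point of the pencil, the matrix is the identity *)
pose e s : F := (s == i0)%:R.
have Dv : \det (\sum_s e s *: D s) != 0.
  rewrite (bigD1 i0) //= big1 => [|s /negPf si]; last by rewrite /e si scale0r.
  by rewrite /e eqxx scale1r addr0 /D mulVmx // det1 oner_eq0.
have [G [H [GH G1 H1]]] := pencil_reducible ND N0 Nu Dv.
have : \det (pencil C) = (mpolyC k (\det (C i0)) * G) * H.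
  rewrite -mulrA -GH -det_map_mx -det_mulmx -pencil_mulmxl.
  congr (\det _); congr (pencil _).
  by apply/funext => i; rewrite mulKVmx.
have detC : \det (C i0) != 0 by rewrite -unitfE -unitmxE.
move=> E; have [] := irr _ _ E; last by rewrite leqNgt H1.
by rewrite mul_mpolyC (msizeZ _ detC) leqNgt G1.
Qed.

(** * Constancy of the second osculating subspace *)

(** Complex differentiability enters only through the symmetry of the second
    derivatives and the constancy of maps with zero derivative, taken here as
    assumptions on an abstract field of scalars. *)
Section Osculation.
Context {C : numFieldType} {V : normedModType C}.
Implicit Types (x v w : V).
Context (schwarz : forall p q (f : V -> 'M[C]_(p, q)) x v w,
  (\near x, differentiable f x) ->
  differentiable ('D_v f) x -> differentiable ('D_w f) x ->
  'D_w ('D_v f) x = 'D_v ('D_w f) x).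
Context (cst_ball : forall p q (f : V -> 'M[C]_(p, q)) x (d : C),
  (forall y, ball x d y -> differentiable f y) ->
  (forall y v, ball x d y -> 'D_v f y = 0) ->
  forall y, ball x d y -> f y = f x).

(** The structure equation d(da) = 0, for da written in the moving frame [W]
    with coefficients [G]. *)
Lemma derive_structure_eq k j N (a : V -> 'M[C]_(k, N)) (W : V -> 'M[C]_(j, N))
    (G : V -> V -> 'M[C]_(k, j)) x v w :
  (\near x, differentiable a x) ->
  (forall u, differentiable ('D_u a) x) -> differentiable W x ->
  (forall u, differentiable (G u) x) ->
  (forall u, \forall y \near x, 'D_u a y = G u y *m W y) ->
  'D_w (G v) x *m W x + G v x *m 'D_w W x =
  'D_v (G w) x *m W x + G w x *m 'D_v W x.
Proof.
move=> da dDa dW dG Da.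
rewrite -(derive_mulmx w (dG v) dW) -(derive_mulmx v (dG w) dW).
rewrite -(near_eq_derive _ (Da v)) -(near_eq_derive _ (Da w)).
exact: schwarz.
Qed.

(** A family of [k]-dimensional subspaces (the row spaces of [a]), immersed in
    the Grassmannian, whose first derivatives leave it along one more dimension
    only, stays in a fixed subspace of dimension [k + 1]. *)
Lemma osculating_space_constant k N (a : V -> 'M[C]_(k, N)) (U : set V) x0 :
  open U -> U x0 ->
  (forall s : V, exists v, forall c, v != c *: s) ->
  (forall y, U y -> differentiable a y) ->
  (forall y v, U y -> differentiable ('D_v a) y) ->
  (forall y, U y -> row_free (a y)) ->
  (forall y v, U y -> ('D_v a y <= a y)%MS -> v = 0) ->
  (forall y, U y -> exists w : 'rV[C]_N, forall v, ('D_v a y <= a y + w)%MS) ->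
  exists2 P : 'M[C]_(k + 1, N), row_free P & \forall y \near x0, (a y <= P)%MS.
Proof.
move=> oU Ux0 Vbig da dDa afree Ginj osc.
have [v0 v0P] := Vbig 0.
have v00 : v0 != 0 by have := v0P 0; rewrite scaler0.
have /row_subPn[p0 gna] : ~~ ('D_v0 a x0 <= a x0)%MS.
  by apply: contra v00 => /(Ginj _ _ Ux0) ->.
(* near x0, the rows of W are a basis of the osculating subspace *)
pose g y := row p0 ('D_v0 a y).
pose W y := col_mx (a y) (g y).
have dg y : U y -> differentiable g y.
  by move=> Uy; exact/differentiable_row/dDa.
have dW y : U y -> differentiable W y.
  by move=> Uy; apply: differentiable_col_mx; [exact: da|exact: dg].
have W0free : row_free (W x0).
  rewrite /row_free eqn_leq rank_leq_row /= -addsmxE.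
  have : (a x0 < a x0 + g x0)%MS.
    rewrite ltmxE addsmxSl /=; apply: contra gna => /(submx_trans _) -> //.
    exact: addsmxSr.
  by move/rank_ltmx; rewrite (eqP (afree _ Ux0)) addn1.
(* coordinates on the osculating subspace at x0, hence on the nearby ones *)
have /row_freeP[K WK1] := W0free.
have dWK y : U y -> differentiable (fun y => W y *m K) y.
  by move=> Uy; apply: differentiable_mulmx; [exact: dW|exact: differentiable_mxcst].
have : \forall y \near x0, U y /\ W y *m K \in unitmx.
  apply: filterI; first exact: open_nbhs_nbhs.
  by apply: near_unitmx (dWK _ Ux0) _; rewrite /= WK1 unitmx1.
move=> /nbhs_ballP[d /= d0 Bsub].
pose B := ball x0 d.
have BU y : B y -> U y by move=> /Bsub[].
have BK y : B y -> W y *m K \in unitmx by move=> /Bsub[].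
have nearB y : B y -> \forall z \near y, B z.
  by move=> By; apply: open_nbhs_nbhs; split => //; exact: ball_open.
have Wfree y : B y -> row_free (W y).
  move=> /BK WKu; apply/row_freeP; exists (K *m invmx (W y *m K)).
  by rewrite mulmxA mulmxV.
have aW y : (a y <= W y)%MS by rewrite -addsmxE addsmxSl.
have DaW y v : B y -> ('D_v a y <= W y)%MS.
  move=> By; have [w wP] := osc _ (BU _ By).
  apply: submx_trans (wP v) _.
  have Ww : (W y <= a y + w)%MS.
    by rewrite -addsmxE addsmx_sub addsmxSl (submx_trans (row_sub _ _) (wP v0)).
  rewrite -(geq_leqif (mxrank_leqif_sup Ww)) (eqP (Wfree _ By)).
  apply: leq_trans (mxrank_adds_leqif _ _) _; rewrite leq_add //.
    exact: rank_leq_row.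
  exact: rank_leq_row.
pose G v y := 'D_v a y *m K *m invmx (W y *m K).
have DaG y v : B y -> 'D_v a y = G v y *m W y.
  move=> By; have /submxP[X DX] := DaW _ v By.
  by rewrite /G DX -(mulmxA X) mulmxK ?BK.
have dG y v : B y -> differentiable (G v) y.
  move=> By; apply: differentiable_mulmx.
    by apply: differentiable_mulmx; [exact/dDa/BU|exact: differentiable_mxcst].
  by apply: differentiable_invmx; [exact/dWK/BU|exact: BK].
have GB y v c s : B y -> G (v - c *: s) y = G v y - c *: G s y.
  move=> By; rewrite /G derive_linear; last exact/da/BU.
  by rewrite !mulmxBl -!scalemxAl.
move: G DaG dG GB => G DaG dG GB.
(* the key point: the second derivatives of a do not leave W either *)
have DgW y s : B y -> ('D_s g y <= W y)%MS.
  move=> By; have Uy := BU _ By.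
  (* multiplication by Z is reduction modulo W y *)
  pose Z := cokermx (W y); have WZ : W y *m Z = 0 by exact: mulmx_coker.
  have DaZ v : 'D_v a y *m Z = 0 by apply/eqP; rewrite -submxE DaW.
  rewrite submxE -/Z; apply/rV0Pn => -[j gj].
  (* rsubmx (G v y) is the column mu_v of coefficients of g in D_v a *)
  have str v : rsubmx (G v y) *m ('D_s g y *m Z) = rsubmx (G s y) *m ('D_v g y *m Z).
    have red u1 u2 : ('D_u1 (G u2) y *m W y + G u2 y *m 'D_u1 W y) *m Z =
        rsubmx (G u2 y) *m ('D_u1 g y *m Z).
      rewrite mulmxDl -!mulmxA WZ mulmx0 add0r.
      rewrite (derive_col_mx _ (da _ Uy) (dg _ Uy)) mul_col_mx DaZ.
      by rewrite -{1}[G u2 y]hsubmxK mul_row_col mulmx0 add0r.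
    have Da : \near y, differentiable a y.
      by apply: filterS (nearB _ By) => z /BU; exact: da.
    have DaE u : \forall z \near y, 'D_u a z = G u z *m W z.
      by apply: filterS (nearB _ By) => z; exact: DaG.
    have E := derive_structure_eq v s Da (fun u => dDa y u Uy) (dW y Uy)
      (fun u => dG y u By) DaE.
    exact: (eq_trans (esym (red s v)) (eq_trans (congr1 (mulmx^~ Z) E) (red v s))).
  (* for v not a multiple of s, mu_v and mu_s cannot be proportional *)
  have [v vP] := Vbig s.
  pose c := ('D_v g y *m Z) 0 j / ('D_s g y *m Z) 0 j.
  have /eqP := vP c; apply; apply/eqP; rewrite -subr_eq0; apply/eqP.
  apply: (Ginj y) => //; rewrite (DaG _ _ By).
  have -> : G (v - c *: s) y = row_mx (lsubmx (G (v - c *: s) y)) 0.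
    rewrite -{1}[G _ y]hsubmxK; congr row_mx.
    by rewrite GB // linearB linearZ /= (outer_product_eq (str v) gj) subrr.
  by rewrite mul_row_col mul0mx addr0 submxMl.
have DWW y s : B y -> ('D_s W y <= W y)%MS.
  move=> By; have Uy := BU _ By.
  by rewrite (derive_col_mx _ (da _ Uy) (dg _ Uy)) -addsmxE addsmx_sub DaW ?DgW.
(* the basis of the row space of W normalized by S *m K = 1: a constant row
   space makes it constant *)
pose S y := invmx (W y *m K) *m W y.
have dS y : B y -> differentiable S y.
  move=> By; apply: differentiable_mulmx; last exact/dW/BU.
  by apply: differentiable_invmx; [exact/dWK/BU|exact: BK].
have DS y v : B y -> 'D_v S y = 0.
  move=> By; have /submxP[Q DQ] := DWW _ v By.
  have SW : \forall z \near y, W z *m K *m S z = W z.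
    by apply: filterS (nearB _ By) => z Bz; rewrite /S mulmxA mulmxV ?BK ?mul1mx.
  have Sy := nbhs_singleton SW.
  have := near_eq_derive v SW.
  rewrite (derive_mulmx v (dWK _ (BU _ By)) (dS _ By)).
  rewrite derive_mulmxr; last exact/dW/BU.
  move: ('D_v S y) => DSy.
  rewrite DQ -(mulmxA Q) -(mulmxA Q) Sy -[RHS]addr0 => /addrI.
  move=> /(congr1 (mulmx (invmx (W y *m K)))).
  by rewrite mulKmx ?BK // mulmx0.
have cstS := cst_ball dS DS.
exists (S x0).
  by apply/row_freeP; exists K; rewrite /S -mulmxA mulVmx // BK //; exact: ballxx.
apply: filterS (nearB x0 (ballxx _ d0)) => y By.
apply: submx_trans (aW y) _.
by apply/submxP; exists (W y *m K); rewrite -(cstS _ By) /S mulmxA mulmxV ?BK ?mul1mx.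
Qed.

End Osculation.

(** * Structure equations of a moving frame *)

Lemma commuting_entry (K : fieldType) n (X Y a b F : 'M[K]_n) i j :
  F \in unitmx -> X i j = 0 -> Y i j = 0 ->
  X *m F + a *m (b *m F) = Y *m F + b *m (a *m F) ->
  (a *m b) i j = (b *m a) i j.
Proof.
move=> Fu X0 Y0; rewrite !mulmxA -!mulmxDl => /(can_inj (mulmxK Fu))/matrixP/(_ i j).
by rewrite mxE [RHS]mxE X0 Y0 !add0r.
Qed.

(** [om q] stands for the matrix (omega_a^b) evaluated on the [q]-th coordinate
    vector; [normal_forms] and [focal_forms] are then the matrices B^alpha and
    C_i. *)
Section ConnectionAlgebra.
Context {K : fieldType} {l r m : nat}.
Context (om : 'I_r -> 'M[K]_(l.+1 + r + m)).

Definition normal_forms (al : 'I_m) : 'M[K]_r :=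
  \matrix_(q, p) om q (lshift m (rshift l.+1 p)) (rshift (l.+1 + r) al).
Definition focal_forms (i : 'I_l.+1) : 'M[K]_r :=
  \matrix_(p, q) om q (lshift m (lshift r i)) (lshift m (rshift l.+1 p)).

Context (om0 : forall q i al,
  om q (lshift m (lshift r i)) (rshift (l.+1 + r) al) = 0).

Lemma normal_focal_formsE al i q s :
  (normal_forms al *m focal_forms i) q s =
  (om s *m om q) (lshift m (lshift r i)) (rshift (l.+1 + r) al).
Proof.
rewrite mxE [RHS]mxE !big_split_ord /= [X in _ = X + _ + _]big1 ?add0r; last first.
  by move=> j _; rewrite om0 mulr0.
rewrite [X in _ = _ + X]big1 ?addr0; last by move=> j _; rewrite om0 mul0r.
by apply: eq_bigr => p _; rewrite !mxE mulrC.
Qed.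

Lemma normal_part_rank1 (v : 'rV[K]_r) (c : 'I_m -> K) al0 :
  (forall al, normal_forms al = c al *: normal_forms al0) ->
  rsubmx (usubmx (\sum_q v 0 q *: om q)) =
  (\col_a (\sum_q v 0 q *: om q) (lshift m a) (rshift (l.+1 + r) al0)) *m
  (\row_al c al).
Proof.
move=> cB; apply/matrixP => a al; rewrite !mxE big_ord1 !mxE !summxE mulr_suml.
apply: eq_bigr => q _; rewrite !mxE -mulrA; congr (_ * _).
case: (fintype.split_ordP a) => [i|p] ->; first by rewrite !om0 mul0r.
by have /matrixP/(_ q p) := cB al; rewrite !mxE mulrC.
Qed.

End ConnectionAlgebra.

(** The last assumption, that the derivatives of A_0, ..., A_l are tangent, is
    the equation omega_i^alpha = 0. *)
Section MovingFrame.
Context {C : numFieldType} {l r m : nat}.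
Local Notation V := ('rV[C]_r).
Context (schwarz : forall p q (f : V -> 'M[C]_(p, q)) x v w,
  (\near x, differentiable f x) ->
  differentiable ('D_v f) x -> differentiable ('D_w f) x ->
  'D_w ('D_v f) x = 'D_v ('D_w f) x).
Context (F : V -> 'M[C]_(l.+1 + r + m)) (Y : set V).
Context (oY : open Y).
Context (dF : forall y, Y y -> differentiable F y).
Context (dDF : forall y v, Y y -> differentiable ('D_v F) y).
Context (Fu : forall y, Y y -> F y \in unitmx).
Context (F1 : forall y v, Y y ->
  ('D_v (fun y => usubmx (usubmx (F y))) y <= usubmx (F y))%MS).

Definition connection (v : V) (y : V) : 'M[C]_(l.+1 + r + m) := 'D_v F y *m invmx (F y).
Definition connection_forms y (q : 'I_r) := connection (delta_mx 0 q) y.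

Lemma connection_differentiable v y : Y y -> differentiable (connection v) y.
Proof.
move=> Yy; apply: differentiable_mulmx; first exact: dDF.
by apply: differentiable_invmx; [exact: dF | exact: Fu].
Qed.

Lemma derive_frame v y : Y y -> 'D_v F y = connection v y *m F y.
Proof. by move=> Yy; rewrite /connection mulmxKV // Fu. Qed.

Lemma generator_normal_entry0 y v i al : Y y -> connection v y (lshift m (lshift r i)) (rshift (l.+1 + r) al) = 0.
Proof.
move=> Yy; have := F1 v Yy; rewrite derive_usubmx; last first.
  by apply: differentiable_usubmx; exact: dF.
rewrite derive_usubmx; last exact: dF.
move=> /submxP[X DX].
have /(congr1 (fun Z => usubmx (usubmx Z))) := derive_frame v Yy.
have -> : usubmx (usubmx (connection v y *m F y)) = usubmx (usubmx (connection v y)) *m F y.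
  by rewrite !mul_usub_mx.
rewrite DX.
have -> : X *m usubmx (F y) = row_mx X 0 *m F y.
  by rewrite -{2}[F y]vsubmxK mul_row_col mul0mx addr0.
move=> /(can_inj (mulmxK (Fu Yy)))/matrixP/(_ i (rshift (l.+1 + r) al)).
by rewrite row_mxEr !mxE.
Qed.

Lemma connection_linear v y : Y y -> connection v y = \sum_q v 0 q *: connection_forms y q.
Proof.
move=> Yy; rewrite /connection_forms /connection {1}(row_sum_delta v) deriveE; last exact: dF.
rewrite linear_sum mulmx_suml; apply: eq_bigr => q _.
by rewrite linearZ -scalemxAl deriveE //; exact: dF.
Qed.

(** The (i, alpha) entry of the structure equation
    d(omega) = omega /\ omega: as omega_i^alpha = 0, it says that
    sum_p omega_i^p /\ omega_p^alpha = 0. *)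
Lemma normal_focal_sym y i al : Y y ->
  (normal_forms (connection_forms y) al *m focal_forms (connection_forms y) i)^T =
  normal_forms (connection_forms y) al *m focal_forms (connection_forms y) i.
Proof.
move=> Yy.
pose I0 := lshift m (lshift r i); pose A0 := rshift (l.+1 + r) al.
have dcon0 v w : 'D_w (connection v) y I0 A0 = 0.
  have dcon := connection_differentiable v Yy.
  refine (eq_trans (esym (derive_coord _ _ _ dcon)) _).
  have E : \forall z \near y, connection v z I0 A0 = cst 0 z.
    by apply: filterS (open_nbhs_nbhs (conj oY Yy)) => z; exact: generator_normal_entry0.
  by rewrite (near_eq_derive _ E) derive_cst.
have nY : \forall z \near y, Y z by exact: open_nbhs_nbhs.
have S v w : (connection v y *m connection w y) I0 A0 = (connection w y *m connection v y) I0 A0.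
  have dFn : \near y, differentiable F y by apply: filterS nY.
  have nearE u : \forall z \near y, 'D_u F z = connection u z *m F z.
    by apply: filterS nY => z; exact: derive_frame.
  have := derive_structure_eq schwarz v w dFn (fun u => dDF u Yy) (dF Yy)
    (fun u => connection_differentiable u Yy) nearE.
  rewrite (derive_frame w Yy) (derive_frame v Yy).
  exact: commuting_entry (Fu Yy) (dcon0 v w) (dcon0 w v).
have om0 q i' al' := generator_normal_entry0 (delta_mx 0 q) i' al' Yy.
apply/matrixP => q s; rewrite mxE.
refine (eq_trans (normal_focal_formsE om0 _ _ _ _) _).
refine (eq_trans _ (esym (normal_focal_formsE om0 _ _ _ _))).
exact: S.
Qed.

Lemma second_form_differentiable y al i : Y y ->
  differentiable (fun z => normal_forms (connection_forms z) al *m focal_forms (connection_forms z) i) y.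
Proof.
move=> Yy; apply: differentiable_mulmx; apply/differentiable_mxP => p q.
  under eq_fun do rewrite mxE; apply: differentiable_mx_coord.
  exact: connection_differentiable.
under eq_fun do rewrite mxE; apply: differentiable_mx_coord.
exact: connection_differentiable.
Qed.

(** When all the B^alpha are multiples of one, the normal parts of the
    derivatives of the tangent subspace are multiples of the one vector
    sum_alpha c_alpha A_alpha. *)
Lemma osculating_line y al0 : Y y ->
  (forall al, exists c, normal_forms (connection_forms y) al = c *: normal_forms (connection_forms y) al0) ->
  exists w : 'rV[C]_(l.+1 + r + m),
  forall v, ('D_v (fun y => usubmx (F y)) y <= usubmx (F y) + w)%MS.
Proof.
move=> Yy /choice[c cB].
exists ((\row_al c al) *m dsubmx (F y)) => v.
rewrite derive_usubmx; last exact: dF.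
rewrite derive_frame // -mul_usub_mx -{1}[F y]vsubmxK -{1}[usubmx (connection v y)]hsubmxK mul_row_col.
apply: addmx_sub_adds; first exact: submxMl.
have om0 q i' al' := generator_normal_entry0 (delta_mx 0 q) i' al' Yy.
rewrite (connection_linear v Yy) (normal_part_rank1 om0 v cB).
by rewrite -mulmxA submxMl.
Qed.

(** The differential of the Gauss map sends [v] to the derivative of the
    tangent subspace in the direction [v], modulo this subspace: it has rank [r]
    exactly when no nonzero derivative stays in the tangent subspace. *)
Lemma gauss_rank_inj y v : Y y ->
  \rank (\matrix_(q < r) mxvec (ursubmx (connection_forms y q))) = r ->
  ('D_v (fun y => usubmx (F y)) y <= usubmx (F y))%MS -> v = 0.
Proof.
move=> Yy rk; rewrite derive_usubmx; last exact: dF.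
move=> /submxP[X DX].
have ur0 : ursubmx (connection v y) = 0.
  have /(congr1 (@usubmx _ _ _ _)) := derive_frame v Yy.
  rewrite DX -mul_usub_mx.
  have -> : X *m usubmx (F y) = row_mx X 0 *m F y.
    by rewrite -{2}[F y]vsubmxK mul_row_col mul0mx addr0.
  by move=> /(can_inj (mulmxK (Fu Yy))); rewrite /ursubmx => <-; rewrite row_mxKr.
set G := \matrix_(q < r) _ in rk.
have vG : v *m G = 0.
  rewrite mulmx_sum_row -[RHS](linear0 mxvec) -ur0 (connection_linear v Yy).
  rewrite /ursubmx !linear_sum /=; apply: eq_bigr => q _.
  by rewrite rowK /ursubmx !linearZ.
have Gfree : row_free G by rewrite /row_free rk.
by apply: (row_free_injr Gfree); rewrite /= vG mul0mx.
Qed.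

End MovingFrame.

Section GaussRank.
Context {C : numFieldType} {l r m : nat}.
Local Notation V := ('rV[C]_r).
Context (F : V -> 'M[C]_(l.+1 + r + m)) (y : V).
Context (dF : differentiable F y) (Fu : F y \in unitmx).

Lemma inj_gauss_rank :
  (forall v, ('D_v (fun y => usubmx (F y)) y <= usubmx (F y))%MS -> v = 0) ->
  \rank (\matrix_(q < r) mxvec (ursubmx (connection_forms F y q))) = r.
Proof.
move=> Finj; apply/eqP; rewrite -/(row_free _) -kermx_eq0.
apply/rowV0P => v /sub_kermxP; rewrite mulmx_sum_row => vG.
apply: Finj; rewrite derive_usubmx //.
have ur0 : ursubmx (connection F v y) = 0.
  apply: (can_inj mxvecK); rewrite linear0 -[RHS]vG.
  rewrite /connection {1}(row_sum_delta v) deriveE // linear_sum mulmx_suml /ursubmx !linear_sum.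
  apply: eq_bigr => q _; rewrite rowK /connection_forms /connection /ursubmx.
  by rewrite linearZ -scalemxAl !linearZ deriveE.
have -> : 'D_v F y = connection F v y *m F y by rewrite /connection mulmxKV.
rewrite -mul_usub_mx -{1}[F y]vsubmxK -[usubmx (connection F v y)]hsubmxK mul_row_col.
by rewrite -/(ursubmx _) ur0 mul0mx addr0 submxMl.
Qed.

End GaussRank.

(** * Adapted frames in a chart *)

Lemma chart_inv_cvg (R : realType) (M : topologicalType) r (c : chart R M r) u :
  cdom c u -> cinv c @ cmap c u --> u.
Proof.
move=> cu; have : {in cmap c @` cdom c, continuous (cinv c)}.
  rewrite -continuous_open_subspace; first exact: chart_inv_continuous.
  exact: chart_open_image.
have uI : cmap c u \in cmap c @` cdom c by rewrite inE; exists u.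
by move/(_ _ uI); rewrite /continuous_at (chartK cu).
Qed.

Lemma chart_cvg (R : realType) (M : topologicalType) r (c : chart R M r) u :
  cdom c u -> cmap c @ u --> cmap c u.
Proof.
move=> cu; have : {in cdom c, continuous (cmap c)}.
  rewrite -continuous_open_subspace; first exact: chart_continuous.
  exact: chart_open.
by apply; rewrite inE.
Qed.

Lemma chart_image_open_sub (R : realType) (M : topologicalType) r (c : chart R M r) (V : set M) :
  open V -> V `<=` cdom c -> open (cmap c @` V).
Proof.
move=> oV Vc; rewrite openE => y [u Vu <-].
have cV : {in cmap c @` cdom c, continuous (cinv c)}.
  rewrite -continuous_open_subspace; first exact: chart_inv_continuous.
  exact: chart_open_image.
have uI : (cmap c @` cdom c) (cmap c u) by exists u => //; exact: Vc.
have nV : \forall z \near cmap c u, V (cinv c z).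
  apply: (cV (cmap c u)); first by rewrite inE.
  by rewrite (chartK (Vc _ Vu)); apply: open_nbhs_nbhs.
have nI : \forall z \near cmap c u, (cmap c @` cdom c) z.
  by apply: open_nbhs_nbhs; split => //; exact: chart_open_image.
apply: filterS2 nI nV => z [w cw <-]; by rewrite chartK // => Vw; exists w.
Qed.

Section AdaptedFrame.
Context {R : realType} {M : topologicalType} {l r m : nat}.
Context (At : complex_atlas R M r) (L : M -> 'M[R[i]]_(l.+1, l.+1 + r + m)).
Context (T : M -> 'M[R[i]]_(l.+1 + r, l.+1 + r + m)).
Context (c : chart R M r) (V : set M) (A : M -> 'M[R[i]]_(l.+1 + r + m)).
Context (adA : adapted_frame At L T c V A).
Local Notation F := (A \o cinv c).
Local Notation Y := (cmap c @` V).

Lemma frame_open : open Y.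
Proof. by case: adA => _ oV Vc _ _; exact: chart_image_open_sub. Qed.

Lemma frame_chartK u : V u -> cinv c (cmap c u) = u.
Proof. by case: adA => _ _ Vc _ _ /Vc; exact: chartK. Qed.

Lemma frameE u : V u -> F (cmap c u) = A u.
Proof. by move=> Vu; rewrite /= frame_chartK. Qed.

Lemma frame_differentiable y : Y y -> differentiable F y.
Proof. by case: adA => _ _ _ /(_ 1%N)[+ _] _ => /(_ y). Qed.

Lemma frame_derive_differentiable y v : Y y -> differentiable ('D_v F) y.
Proof. by case: adA => _ _ _ /(_ 2%N)[_ /(_ v)[+ _]] _ => /(_ y). Qed.

Lemma frame_unit y : Y y -> F y \in unitmx.
Proof.
by move=> [u Vu <-]; rewrite frameE //; case: adA => _ _ _ _ /(_ u Vu)[].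
Qed.

Lemma omega_connection u : V u -> (fun q => omega c A q u) = connection_forms F (cmap c u).
Proof.
move=> Vu; apply/funext => q; rewrite /omega /connection_forms /connection /partial.
by rewrite -(frameE Vu).
Qed.

Lemma BmxE u al : V u -> Bmx c A u al = normal_forms (connection_forms F (cmap c u)) al.
Proof.
by move=> Vu; rewrite -omega_connection //; apply/matrixP => q p; rewrite !mxE.
Qed.

Lemma CmxE u i : V u -> Cmx c A u i = focal_forms (connection_forms F (cmap c u)) i.
Proof.
by move=> Vu; rewrite -omega_connection //; apply/matrixP => q p; rewrite !mxE.
Qed.

Lemma param_partial x u q : V u ->
  partial c q (param A x) u =
  x *m usubmx (usubmx ('D_(delta_mx 0 q) F (cmap c u))).
Proof.
move=> Vu; have Yu : Y (cmap c u) by exists u.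
have dF := frame_differentiable Yu.
have dFu := differentiable_usubmx dF.
have dFuu := differentiable_usubmx dFu.
refine (eq_trans (derive_mulmxl x (delta_mx 0 q) dFuu) _); congr (_ *m _).
refine (eq_trans (derive_usubmx _ dFu) _); congr usubmx.
exact: (derive_usubmx _ dF).
Qed.

Lemma frame_span u : V u -> (usubmx (F (cmap c u)) :=: T u)%MS.
Proof. by move=> Vu; rewrite frameE //; case: adA => _ _ _ _ /(_ u Vu)[]. Qed.

Context (X : set 'rV[R[i]]_(l.+1 + r + m)) (hX : degenerate_gauss At X L T).

Lemma tangent_mxE x u : V u ->
  tangent_mx c A x u = col_mx (usubmx (usubmx (F (cmap c u))))
    (\matrix_(q < r) (x *m usubmx (usubmx ('D_(delta_mx 0 q) F (cmap c u))))).
Proof.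
move=> Vu; rewrite /tangent_mx frameE //; congr col_mx.
by apply/row_matrixP => q; rewrite !rowK; exact: param_partial.
Qed.

Lemma frame_generators_tangent y v : Y y ->
  ('D_v (fun y => usubmx (usubmx (F y))) y <= usubmx (F y))%MS.
Proof.
move=> Yy; have [u Vu yE] := Yy; have dF := frame_differentiable Yy.
have dFu := differentiable_usubmx dF.
rewrite (derive_usubmx _ dFu) (derive_usubmx _ dF).
rewrite -{2}yE; rewrite (frame_span Vu).
have key q : (usubmx (usubmx ('D_(delta_mx 0 q) F y)) <= T u)%MS.
  apply: (@generic_tangent _ _ _ _ _ (usubmx (usubmx (F y)))
    (fun q => usubmx (usubmx ('D_(delta_mx 0 q) F y)))).
    have [x] := dg_dim hX adA Vu; rewrite (tangent_mxE x Vu) yE.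
    by exists x.
  move=> x; have := dg_tangent hX adA Vu (x := x).
  by rewrite (tangent_mxE x Vu) yE => H /H ->.
have -> : 'D_v F y = \sum_q v 0 q *: 'D_(delta_mx 0 q) F y.
  rewrite {1}(row_sum_delta v) (deriveE _ dF) linear_sum.
  by apply: eq_bigr => q _; rewrite linearZ (deriveE _ dF).
rewrite !linear_sum; apply: summx_sub => q _.
by rewrite !linearZ; exact: scalemx_sub (key q).
Qed.

Lemma frame_gauss_inj y v : Y y ->
  ('D_v (fun y => usubmx (F y)) y <= usubmx (F y))%MS -> v = 0.
Proof.
move=> Yy; apply: (gauss_rank_inj frame_differentiable frame_unit Yy).
case: Yy => u Vu <-.
refine (eq_trans _ (dg_rank hX adA Vu)).
exact: (congr1 (fun f => \rank (\matrix_(q < r) mxvec (ursubmx (f q))))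
  (esym (omega_connection Vu))).
Qed.

Lemma symmetric_second_forms y i al : Y y ->
  (normal_forms (connection_forms F y) al *m focal_forms (connection_forms F y) i)^T =
  normal_forms (connection_forms F y) al *m focal_forms (connection_forms F y) i.
Proof.
apply: normal_focal_sym.
- by move=> p q f x v w; exact: derive_swap_mx.
- exact: frame_open.
- exact: frame_differentiable.
- by move=> z v; exact: frame_derive_differentiable.
- exact: frame_unit.
- by move=> z v; exact: frame_generators_tangent.
Qed.

Context (r2 : (2 <= r)%N).
Context (irrA : forall u, V u -> forall G H, focus_poly c A u = G * H ->
  (msize G <= 1)%N \/ (msize H <= 1)%N).

Lemma normal_forms_proportional y i0 al0 al : Y y ->
  normal_forms (connection_forms F y) al0 *m focal_forms (connection_forms F y) i0 \in unitmx ->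
  exists a, normal_forms (connection_forms F y) al = a *: normal_forms (connection_forms F y) al0.
Proof.
move=> Yy Hu; have r0 : (0 < r)%N by exact: ltnW.
apply: (second_forms_proportional r0 _ _ Hu).
- by move=> i; exact: symmetric_second_forms.
- by move=> i; exact: symmetric_second_forms.
- case: Yy => u Vu yE G H GH; apply: (irrA Vu); rewrite -GH -yE -det_tr.
  congr (\det _); apply/matrixP => p q; rewrite !mxE; apply: eq_bigr => i _.
  by rewrite CmxE.
Qed.

(** A second fundamental form that is nondegenerate at [u0] remains so nearby,
    so that the osculating subspace has dimension n + 2 on a neighbourhood. *)
Lemma local_osculating_space u0 i0 al0 : V u0 -> Hmx c A u0 i0 al0 \in unitmx ->
  exists2 P : 'M[R[i]]_(l.+1 + r + 1, l.+1 + r + m),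
    row_free P & \forall u \near u0, (T u <= P)%MS.
Proof.
move=> Vu0 Hu0; set y0 := cmap c u0.
pose Hf y := normal_forms (connection_forms F y) al0 *m focal_forms (connection_forms F y) i0.
pose U := [set y | Y y /\ Hf y \in unitmx].
have Yy0 : Y y0 by exists u0.
have nY y : Y y -> \forall z \near y, Y z.
  by move=> Yy; apply: open_nbhs_nbhs; split=> //; exact: frame_open.
have dHf y : Y y -> differentiable Hf y.
  apply: second_form_differentiable; first exact: frame_differentiable.
    by move=> z v; exact: frame_derive_differentiable.
  exact: frame_unit.
have oU : open U.
  rewrite openE => y [Yy Hy]; apply: filterI; first exact: nY.
  exact: near_unitmx (dHf _ Yy) Hy.
have HE : Hmx c A u0 i0 al0 = Hf y0.
  refine (eq_trans (congr1 (fun B => B *m Cmx c A u0 i0) (BmxE al0 Vu0)) _).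
  exact: (congr1 (fun C => normal_forms (connection_forms F y0) al0 *m C) (CmxE i0 Vu0)).
have Uy0 : U y0.
  split; first exact: Yy0.
  exact: (eq_ind _ (fun H => is_true (H \in unitmx)) Hu0 _ HE).
have [P Pfree aP] : exists2 P : 'M[R[i]]_(l.+1 + r + 1, l.+1 + r + m),
    row_free P & \forall y \near y0, (usubmx (F y) <= P)%MS.
  apply: (@osculating_space_constant _ _ _ _ _ _ (fun y => usubmx (F y)) U y0 oU Uy0).
  - by move=> p q f x v w; exact: derive_swap_mx.
  - by move=> p q f x d; exact: derive0_cst_ball.
  - by move=> s; have [v vP] := noncollinear_vector s r2; exists v => a; exact: vP.
  - by move=> y [Yy _]; apply: differentiable_usubmx; exact: frame_differentiable.
  - move=> y v [Yy _].
    apply: (@near_eq_differentiable _ _ _ (fun z => usubmx ('D_v F z))).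
      apply: filterS (nY _ Yy) => z Yz; apply: esym; apply: derive_usubmx.
      exact: frame_differentiable.
    by apply: differentiable_usubmx; exact: frame_derive_differentiable.
  - move=> y [Yy _]; exact: usubmx_row_free (frame_unit Yy).
  - by move=> y v [Yy _]; exact: frame_gauss_inj.
  - move=> y [Yy Hy]; apply: (osculating_line _ _ _ Yy).
    + exact: frame_differentiable.
    + exact: frame_unit.
    + by move=> z v; exact: frame_generators_tangent.
    + by move=> al; exact: normal_forms_proportional Hy.
exists P; first exact: Pfree.
have oV : open V by case: adA.
have Vc : V `<=` cdom c by case: adA.
have := chart_cvg (Vc _ Vu0) aP.
apply: filterS2 (open_nbhs_nbhs (conj oV Vu0)) => u Vu /=.
by rewrite -(frame_span Vu).
Qed.

End AdaptedFrame.

(** * Globalization over the parameter space *)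

Section Globalization.
Context {R : realType} {M : topologicalType} {l r m : nat}.
Context (At : complex_atlas R M r) (L : M -> 'M[R[i]]_(l.+1, l.+1 + r + m)).
Context (T : M -> 'M[R[i]]_(l.+1 + r, l.+1 + r + m)).
Context (X : set 'rV[R[i]]_(l.+1 + r + m)) (hX : degenerate_gauss At X L T).
Context (r0 : (0 < r)%N).

(** A subspace that contains [T w] for all [w] near [u] also contains the
    derivatives at [u] of the tangent vectors, one of which is not in [T u].  So
    [T u] and this derivative already span [P]. *)
Lemma osculating_space_unique (P P' : 'M[R[i]]_(l.+1 + r + 1, l.+1 + r + m)) (u : M) :
  (\forall w \near u, (T w <= P)%MS) -> (\forall w \near u, (T w <= P')%MS) ->
  (P <= P')%MS.
Proof.
move=> TP TP'; have [c [V [A [adA Vu]]]] := dg_frame hX u.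
have Vc : V `<=` cdom c by case: adA.
pose F := A \o cinv c; pose y := cmap c u.
have Yy : (cmap c @` V) y by exists u.
have dF : differentiable F y := frame_differentiable adA Yy.
have dFu := differentiable_usubmx dF.
pose v : 'rV[R[i]]_r := delta_mx 0 (Ordinal r0).
have nv : ~~ ('D_v (fun z => usubmx (F z)) y <= usubmx (F y))%MS.
  apply/negP => /(frame_gauss_inj adA hX Yy) /matrixP/(_ 0 (Ordinal r0)).
  by rewrite !mxE !eqxx => /eqP; rewrite oner_eq0.
have FT : \forall z \near y, (usubmx (F z) :=: T (cinv c z))%MS.
  apply: filterS (open_nbhs_nbhs (conj (frame_open adA) Yy)) => z [w Vw <-].
  by rewrite [X in T X](frame_chartK adA Vw); exact: (frame_span adA Vw).
have key (Q : 'M[R[i]]_(l.+1 + r + 1, l.+1 + r + m)) :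
    (\forall w \near u, (T w <= Q)%MS) ->
    (usubmx (F y) + 'D_v (fun z => usubmx (F z)) y <= Q)%MS.
  move=> TQ; have FQ : \forall z \near y, (usubmx (F z) <= Q)%MS.
    by apply: filterS2 FT (chart_inv_cvg (Vc _ Vu) TQ) => z -> .
  rewrite addsmx_sub (nbhs_singleton FQ) /=.
  exact: derive_in_subspace.
apply: submx_trans (key _ TP'); apply: row_free_same_rank_sub (key _ TP).
have Ffree : row_free (usubmx (F y)) := usubmx_row_free (frame_unit adA Yy).
rewrite addn1 -[X in (X < _)%N](eqP Ffree); apply: rank_ltmx.
rewrite ltmxE addsmxSl /=; apply: contra nv; apply: submx_trans.
exact: addsmxSr.
Qed.

(** The set of the points near which [T] stays in [P] is open, and closed by the
    uniqueness of the local osculating subspace. *)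
Lemma global_osculating_space (hM : connected_manifold M) :
  (forall u : M, exists2 P : 'M[R[i]]_(l.+1 + r + 1, l.+1 + r + m),
     row_free P & \forall w \near u, (T w <= P)%MS) ->
  exists2 P : 'M[R[i]]_(l.+1 + r + 1, l.+1 + r + m),
    row_free P & forall u, (T u <= P)%MS.
Proof.
move=> loc; have [u1 _] := manifold_nonempty hM.
have [P Pfree TP] := loc u1; exists P => //.
pose S : set M := [set u : M | \forall w \near u, (T w <= P)%MS].
suff ST : S = setT.
  by move=> u; have Su : S u by [rewrite ST]; exact: (nbhs_singleton Su).
apply: (manifold_connected hM).
- by exists u1.
- exists S; last by rewrite setTI.
  by rewrite openE => u; exact: nbhs_interior.
- exists S; last by rewrite setTI.
  move=> u clu; have [P' _ TP'] := loc u.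
  have [w [Sw Pw]] := clu _ (nbhs_interior TP').
  have P'P : (P' <= P)%MS by exact: osculating_space_unique Pw Sw.
  by apply: filterS TP' => z Tz; exact: submx_trans Tz P'P.
Qed.

End Globalization.

(** * Reduction of the ambient space *)

Section Transfer.
Context {R : realType} {r : nat}.

(** One order of differentiability is given up so that the continuity required
    at order 0 follows from differentiability. *)
Lemma Cn_on_affine k p q p' q' (U U' : set 'rV[R[i]]_r)
    (f : 'rV[R[i]]_r -> 'M[R[i]]_(p, q)) (g : 'rV[R[i]]_r -> 'M[R[i]]_(p', q'))
    (E : 'M[R[i]]_(p', p)) (B : 'M[R[i]]_(q, q')) (D : 'M[R[i]]_(p', q')) :
  open U' -> U' `<=` U -> Cn_on k.+1 U f ->
  (forall y, U' y -> g y = E *m f y *m B + D) -> Cn_on k U' g.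
Proof.
move=> oU' U'U; elim: k f g D => [|k IHk] f g D [df Df] gE.
  move=> x U'x; apply: differentiable_continuous.
  apply: (@differentiable_affine _ _ _ _ _ _ f g E B D x (df _ (U'U _ U'x)) _).1.
  exact: filterS (open_nbhs_nbhs (conj oU' U'x)).
have gA x : U' x -> differentiable g x /\ forall v, 'D_v g x = E *m 'D_v f x *m B + 0.
  move=> U'x; apply: (@differentiable_affine _ _ _ _ _ _ f g E B D x (df _ (U'U _ U'x)) _).
  exact: filterS (open_nbhs_nbhs (conj oU' U'x)).
split=> [x /gA[]//|v].
apply: (IHk ('D_v f) ('D_v g) 0 (Df v)) => x U'x.
exact: (gA x U'x).2.
Qed.

Context {M : topologicalType} {l m1 m2 : nat} (At : complex_atlas R M r).

(** The tangent part of a frame goes through the linear map [B]; it is completed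
    by constant vectors [e], which remain independent of it near [u0].  Both the
    inclusion of a subspace and coordinates on it are of this form. *)
Lemma transfer_frame (L1 : M -> 'M[R[i]]_(l.+1, l.+1 + r + m1))
    (L2 : M -> 'M[R[i]]_(l.+1, l.+1 + r + m2))
    (T1 : M -> 'M[R[i]]_(l.+1 + r, l.+1 + r + m1))
    (T2 : M -> 'M[R[i]]_(l.+1 + r, l.+1 + r + m2))
    (B : 'M[R[i]]_(l.+1 + r + m1, l.+1 + r + m2)) c V A u0 :
  (forall u, L2 u :=: L1 u *m B)%MS -> (forall u, T2 u :=: T1 u *m B)%MS ->
  adapted_frame At L1 T1 c V A -> V u0 -> row_free (usubmx (A u0) *m B) ->
  exists V' A', [/\ adapted_frame At L2 T2 c V' A', V' u0 &
    forall w, usubmx (A' w) = usubmx (A w) *m B].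
Proof.
move=> LB TB adA Vu0 /row_free_complete[e eu].
pose A' w : 'M[R[i]]_(l.+1 + r + m2) := col_mx (usubmx (A w) *m B) e.
have uA' w : usubmx (A' w) = usubmx (A w) *m B by rewrite col_mxKu.
have [cAt oV Vc sA spanA] := adA.
(* A' is an affine function of A, which gives its smoothness *)
pose E : 'M[R[i]]_(l.+1 + r + m2, l.+1 + r + m1) := col_mx (row_mx 1%:M 0) 0.
pose D : 'M[R[i]]_(l.+1 + r + m2, l.+1 + r + m2) := col_mx 0 e.
have A'E w : A' w = E *m A w *m B + D.
  rewrite /E /D mul_col_mx -{1}[A w]vsubmxK mul_row_col mul1mx !mul0mx addr0.
  by rewrite mul_col_mx mul0mx add_col_mx addr0 add0r.
pose V' := [set w | V w /\ A' w \in unitmx].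
have V'V : V' `<=` V by move=> w [].
have dA' u : V u -> differentiable (A' \o cinv c) (cmap c u).
  move=> Vu; have Yu : (cmap c @` V) (cmap c u) by exists u.
  have dA := frame_differentiable adA Yu.
  apply: (@differentiable_affine _ _ _ _ _ _ (A \o cinv c) _ E B D _ dA _).1.
  by apply: filterE => y; exact: A'E.
have oV' : open V'.
  rewrite openE => u [Vu A'u].
  apply: filterI; first exact: open_nbhs_nbhs.
  have A'u' : (A' \o cinv c) (cmap c u) \in unitmx.
    by rewrite /= (chartK (Vc _ Vu)).
  have nu : nbhs u (fun w => A' (cinv c (cmap c w)) \in unitmx).
    exact: (chart_cvg (Vc _ Vu) (near_unitmx (dA' _ Vu) A'u')).
  have nV : nbhs u V by exact: open_nbhs_nbhs.
  apply: filterS (filterI nu nV) => w [+ Vw].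
  by rewrite (chartK (Vc _ Vw)).
exists V', A'; split; [|by split|exact: uA'].
split; [exact: cAt|exact: oV'|by move=> w /V'V/Vc| |].
- move=> k; apply: (@Cn_on_affine k _ _ _ _ (cmap c @` V) _ (A \o cinv c) _ E B D).
  + by apply: chart_image_open_sub => // w /V'V/Vc.
  + by move=> y [w V'w <-]; exists w => //; exact: V'V.
  + exact: sA.
  + by move=> y _; exact: A'E.
- move=> w [Vw A'w]; have [_ LA TA] := spanA _ Vw; split=> //.
  + rewrite uA' -mul_usub_mx.
    by apply: eqmx_trans (eqmxMr B LA) (eqmx_sym (LB w)).
  + rewrite uA'; exact: eqmx_trans (eqmxMr B TA) (eqmx_sym (TB w)).
Qed.

Lemma tangent_mx_mulmx c V (L1 : M -> 'M[R[i]]_(l.+1, l.+1 + r + m1)) T1 A1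
    (A2 : M -> 'M[R[i]]_(l.+1 + r + m2))
    (B : 'M[R[i]]_(l.+1 + r + m1, l.+1 + r + m2)) x u :
  adapted_frame At L1 T1 c V A1 -> V u ->
  (forall w, usubmx (A2 w) = usubmx (A1 w) *m B) ->
  tangent_mx c A2 x u = tangent_mx c A1 x u *m B.
Proof.
move=> adA Vu AB; rewrite /tangent_mx mul_col_mx AB; congr col_mx; first by rewrite !mul_usub_mx.
have Yu : (cmap c @` V) (cmap c u) by exists u.
apply/row_matrixP => q; rewrite row_mul !rowK.
have dp : differentiable (param A1 x \o cinv c) (cmap c u).
  apply: differentiable_mulmx; first exact: differentiable_mxcst.
  apply: differentiable_usubmx; apply: differentiable_usubmx.
  exact: (frame_differentiable adA Yu).
refine (eq_trans _ (derive_mulmxr B (delta_mx 0 q) dp)).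
have fE : param A2 x \o cinv c = (fun y => (param A1 x \o cinv c) y *m B).
  by apply/funext => y; rewrite /= /param AB -mulmxA !mul_usub_mx.
exact: (congr1 (fun f => 'D_(delta_mx 0 q) f (cmap c u)) fE).
Qed.

End Transfer.

Section Reduction.
Context {R : realType} {M : topologicalType} {l r m : nat}.
Context (At : complex_atlas R M r) (X : set 'rV[R[i]]_(l.+1 + r + m)).
Context (L : M -> 'M[R[i]]_(l.+1, l.+1 + r + m)).
Context (T : M -> 'M[R[i]]_(l.+1 + r, l.+1 + r + m)).
Context (hX : degenerate_gauss At X L T).

Lemma generator_sub_tangent u : (L u <= T u)%MS.
Proof.
have [c [V [A [[_ _ _ _ spanA] Vu]]]] := dg_frame hX u.
have [_ LA TA] := spanA u Vu.
rewrite -LA -TA -{2}[usubmx (A u)]vsubmxK -addsmxE; exact: addsmxSl.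
Qed.

(** [pinvmx P] gives the coordinates of the vectors of the row space of [P].
    Every condition on a frame of the reduced family only involves its tangent
    part and the derivatives of the latter, on which the inclusion [P] is
    injective: it can be checked on a frame of the original family. *)
Lemma degenerate_gauss_reduction (P : 'M[R[i]]_(l.+1 + r + 1, l.+1 + r + m)) :
  row_free P -> (forall u, (T u <= P)%MS) ->
  let L' u := L u *m pinvmx P in let T' u := T u *m pinvmx P in
  let X' := [set x | x != 0 /\ exists u, (x <= L' u)%MS] in
  [/\ degenerate_gauss At X' L' T',
      X = [set x *m P | x in X'],
      forall u, (L u :=: L' u *m P)%MS &
      forall u, (T u :=: T' u *m P)%MS].
Proof.
move=> Pfree TP L' T' X'.
have LP u : (L u <= P)%MS := submx_trans (generator_sub_tangent u) (TP u).
have PK : P *m pinvmx P = 1%:M := mulmxVp Pfree.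
have LE u : L' u *m P = L u := mulmxKpV (LP u).
have TE u : T' u *m P = T u := mulmxKpV (TP u).
have LL' u : (L u :=: L' u *m P)%MS by rewrite LE.
have TT' u : (T u :=: T' u *m P)%MS by rewrite TE.
have LL u : (L' u :=: L u *m pinvmx P)%MS by [].
have TT u : (T' u :=: T u *m pinvmx P)%MS by [].
have lift c V A' u : adapted_frame At L' T' c V A' -> V u ->
    exists V1 A, [/\ adapted_frame At L T c V1 A, V1 u &
      forall w, usubmx (A w) = usubmx (A' w) *m P].
  move=> adA' Vu; apply: (transfer_frame LL' TT' adA' Vu).
  apply: row_freeM Pfree; apply: usubmx_row_free.
  by case: adA' => _ _ _ _ /(_ u Vu)[].
have mulPK (k : nat) (Z1 Z2 : 'M[R[i]]_(k, l.+1 + r + 1)) :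
    (Z1 *m P :=: Z2 *m P)%MS -> (Z1 :=: Z2)%MS.
  move=> /(eqmxMr (pinvmx P)) E.
  have /eqmx_sym E1 : (Z1 *m P *m pinvmx P :=: Z1)%MS by rewrite -mulmxA PK mulmx1.
  have E2 : (Z2 *m P *m pinvmx P :=: Z2)%MS by rewrite -mulmxA PK mulmx1.
  exact: eqmx_trans E1 (eqmx_trans E E2).
split; [| |exact: LL'|exact: TT'].
- split.
  + move=> u; have [c [V [A [adA Vu]]]] := dg_frame hX u.
    have Afree : row_free (usubmx (A u) *m pinvmx P).
      apply: (@row_freeMl _ _ _ _ _ P).
      have [Au _ TA] : [/\ A u \in unitmx, (usubmx (usubmx (A u)) :=: L u)%MS
          & (usubmx (A u) :=: T u)%MS] by case: adA => _ _ _ _ /(_ u Vu).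
      rewrite mulmxKpV; first exact: usubmx_row_free.
      by rewrite TA.
    have [V' [A' [adA' V'u _]]] := transfer_frame LL TT adA Vu Afree.
    by exists c, V', A'.
  + by [].
  + move=> c V A' adA' u Vu; have [V1 [A [adA V1u AE]]] := lift _ _ _ _ adA' Vu.
    have [x xfree] := dg_dim hX adA V1u.
    exists x; apply: (@row_freeMl _ _ _ _ _ P).
    by rewrite -(tangent_mx_mulmx x adA' Vu AE).
  + move=> c V A' adA' u Vu x xfree.
    have [V1 [A [adA V1u AE]]] := lift _ _ _ _ adA' Vu.
    apply: mulPK; rewrite TE -(tangent_mx_mulmx x adA' Vu AE).
    apply: (dg_tangent hX adA V1u).
    rewrite (tangent_mx_mulmx x adA' Vu AE); exact: row_freeM xfree Pfree.
  + move=> c V A' adA' u Vu; have [V1 [A [adA V1u AE]]] := lift _ _ _ _ adA' Vu.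
    have Yu : (cmap c @` V) (cmap c u) by exists u.
    have Y1u : (cmap c @` V1) (cmap c u) by exists u.
    have dF := frame_differentiable adA' Yu.
    refine (eq_trans (congr1 (fun f => \rank (\matrix_(q < r) mxvec (ursubmx (f q))))
      (omega_connection adA' Vu)) _).
    apply: (inj_gauss_rank dF (frame_unit adA' Yu)) => v vF.
    apply: (frame_gauss_inj adA hX Y1u).
    have fE : (fun y => usubmx ((A \o cinv c) y)) =
        (fun y => usubmx ((A' \o cinv c) y) *m P).
      by apply/funext => y; exact: AE.
    have -> := congr1 (fun f => ('D_v f (cmap c u) <= f (cmap c u))%MS) fE.
    rewrite (derive_mulmxr P v (differentiable_usubmx dF)).
    exact: submxMr.
- rewrite (dg_points hX); apply/seteqP; split=> x /=.
  + move=> [x0 [u xL]]; have xP := submx_trans xL (LP u).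
    exists (x *m pinvmx P); last exact: mulmxKpV.
    split; last by exists u; exact: submxMr.
    by apply: contraNneq x0 => x'0; rewrite -(mulmxKpV xP) x'0 mul0mx.
  + move=> [x' [x'0 [u x'L]] <-]; split.
      apply: contraNneq x'0 => x'P; rewrite -[x']mulmx1 -PK mulmxA x'P mul0mx.
      by [].
    by exists u; rewrite -(LE u); exact: submxMr.
Qed.

End Reduction.

Unset Implicit Arguments.

Theorem theorem3 (R : realType) (l r m : nat) (hl : (2 <= l)%N) (hr : (2 <= r)%N)
    (M : topologicalType) (At : complex_atlas R M r) (hM : connected_manifold M)
    (X : set 'rV[R[i]]_(l.+1 + r + m))
    (L : M -> 'M[R[i]]_(l.+1, l.+1 + r + m))
    (T : M -> 'M[R[i]]_(l.+1 + r, l.+1 + r + m))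
    (hX : degenerate_gauss At X L T)
    (hreg : regular_second_forms At L T)
    (hmult : forall c V A, adapted_frame At L T c V A ->
       forall u, V u -> no_multiple_components (focus_poly c A u))
    (hindec : forall c V A, adapted_frame At L T c V A ->
       forall u, V u -> indecomposable (focus_poly c A u)) :
  exists (P : 'M[R[i]]_(l.+1 + r + 1, l.+1 + r + m))
         (X' : set 'rV[R[i]]_(l.+1 + r + 1))
         (L' : M -> 'M[R[i]]_(l.+1, l.+1 + r + 1))
         (T' : M -> 'M[R[i]]_(l.+1 + r, l.+1 + r + 1)),
    [/\ row_free P,
        degenerate_gauss At X' L' T',
        X = [set x *m P | x in X'],
        forall u, (L u :=: L' u *m P)%MS &
        forall u, (T u :=: T' u *m P)%MS].
Proof.
have [P Pfree TP] : exists2 P : 'M[R[i]]_(l.+1 + r + 1, l.+1 + r + m),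
    row_free P & forall u, (T u <= P)%MS.
  apply: (global_osculating_space hX (ltnW hr) hM) => u.
  have [c [V [A [adA Vu [i [al Hu]]]]]] := hreg u.
  apply: (local_osculating_space adA hX hr _ Vu Hu) => w Vw.
  exact: indecomposable_irreducible (hmult c V A adA w Vw) (hindec c V A adA w Vw).
have [dg XE LE TE] := degenerate_gauss_reduction hX Pfree TP.
by exists P; do 3 eexists; split; [exact: Pfree | exact: dg | exact: XE | exact: LE | exact: TE].
Qed.
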